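(* Let $\mathbb{P}$ be a complete Boolean algebra and let $\kappa,\lambda$ be cardinals. (1) The implications $$\Sigma_0^{(\mathrm{sim})}\text{-}\mathsf{BN}^\lambda_{\mathbb{P},\kappa}(\infty)\Rightarrow\mathsf{BN}^\lambda_{\mathbb{P},\kappa}(\infty)\Rightarrow\mathsf{BFA}^\lambda_{\mathbb{P},\kappa}$$ hold, and if $\kappa\leq\lambda$, then also $\mathsf{BFA}^\lambda_{\mathbb{P},\kappa}\Rightarrow\Sigma_0^{(\mathrm{sim})}\text{-}\mathsf{BN}^\lambda_{\mathbb{P},\kappa}(\infty)$. (2) For any ordinal $\alpha>0$ and any transitive set $X$ of size at most $\kappa$: $\Sigma_0^{(\mathrm{sim})}\text{-}\mathsf{BN}^\lambda_{\mathbb{P},X,\kappa}(\alpha)\Rightarrow\mathsf{BN}^\lambda_{\mathbb{P},X,\kappa}(\alpha)$; if $|\mathcal{P}^{<\alpha}(X)|\geq\kappa$, then $\mathsf{BN}^\lambda_{\mathbb{P},X,\kappa}(\alpha)\Rightarrow\mathsf{BFA}^\lambda_{\mathbb{P},\kappa}$; and if $\kappa\leq\lambda$, then $\mathsf{BFA}^\lambda_{\mathbb{P},\kappa}\Rightarrow\Sigma_0^{(\mathrm{sim})}\text{-}\mathsf{BN}^\lambda_{\mathbb{P},X,\kappa}(\alpha)$.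
   Context: Forcing with a complete Boolean algebra means forcing with its nonzero elements; $\mathbb{P}\Vdash\varphi$ means $1_{\mathbb P}\Vdash\varphi$; $V$ is the ground model. $\mathsf{BFA}^\lambda_{\mathbb{P},\kappa}$: for any sequence $\langle D_\gamma\mid\gamma<\kappa\rangle$ of predense subsets of $\mathbb{P}$, each of size at most $\lambda$, there is a filter $g\in V$ on $\mathbb{P}$ with $g\cap D_\gamma\neq\emptyset$ for all $\gamma<\kappa$. Iterated power sets: $\mathcal{P}^0(X)=X$, $\mathcal{P}^{<\alpha}(X)=\bigcup_{\beta<\alpha}\mathcal{P}^\beta(X)$, and $\mathcal{P}^\alpha(X)=\mathcal{P}(\mathcal{P}^{<\alpha}(X))$ for $\alpha>0$. Rank of names: a name $\sigma$ is a rank $0$ $X$-name if $\sigma=\check{x}$ for some $x\in X$; otherwise $\sigma$ is a rank $\alpha$ $X$-name, where $\alpha=\sup\{\mathrm{rank}(\tau)+1\mid\exists p\in\mathbb{P}\ (\tau,p)\in\sigma\}$. A name $\sigma$ is locally $\kappa$-small if there are at most $\kappa$ many names $\tau$ such that $(\tau,p)\in\sigma$ for some $p$; it is $\kappa$-small if it is locally $\kappa$-small and each such $\tau$ is (recursively) $\kappa$-small. A name $\sigma$ is locally $\lambda$-bounded if $\sigma=\{(\tau,p)\mid\tau\in T,\ p\in S_\tau\}$ for a set $T$ of names and sets $S_\tau\subseteq\mathbb{P}$ of size at most $\lambda$; it is $\lambda$-bounded if it is locally $\lambda$-bounded and each $\tau\in T$ is (recursively) $\lambda$-bounded. For a filter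 $g$ (not assumed generic), $\sigma^g=\{\tau^g\mid\exists p\in g\ (\tau,p)\in\sigma\}$. $H_{\kappa^+}$ is the set of sets hereditarily of size at most $\kappa$. $\mathsf{BN}^\lambda_{\mathbb{P},X,\kappa}(\alpha)$ (for $X$ transitive of size at most $\kappa$): whenever $\sigma$ is a $\kappa$-small $\lambda$-bounded $X$-name of rank $\leq\alpha$ and $A\in H_{\kappa^+}\cap\mathcal{P}^\alpha(X)$ is such that $\mathbb{P}\Vdash\sigma=\check{A}$, there is a filter $g\in V$ on $\mathbb{P}$ with $\sigma^g=A$. $\mathsf{BN}^\lambda_{\mathbb{P},\kappa}(\infty)$: $\mathsf{BN}^\lambda_{\mathbb{P},X,\kappa}(\alpha)$ holds for all ordinals $\alpha$ and all transitive $X\in H_{\kappa^+}$. $\Sigma_0^{(\mathrm{sim})}\text{-}\mathsf{BN}^\lambda_{\mathbb{P},X,\kappa}(\alpha)$: whenever $\sigma_0,\dots,\sigma_n$ are $\kappa$-small $\lambda$-bounded $X$-names of rank $\leq\alpha$, there is a filter $g\in V$ on $\mathbb{P}$ such that $\varphi(\sigma_0^g,\dots,\sigma_n^g)$ holds in $V$ for every $\Sigma_0$-formula $\varphi$ (bounded quantifiers allowed) with $\mathbb{P}\Vdash\varphi(\sigma_0,\dots,\sigma_n)$. $\Sigma_0^{(\mathrm{sim})}\text{-}\mathsf{BN}^\lambda_{\mathbb{P},\kappa}(\infty)$: the same statement for $\kappa$-small $\lambda$-bounded $X$-names of arbitrary rank, for some transitive $X\in H_{\kappa^+}$. *)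

(* Defs.v *)
From HB Require Import structures.
From mathcomp Require Import all_boot all_order.
From mathcomp Require Import boolp classical_sets functions cardinality.

Set Implicit Arguments.
Unset Strict Implicit.
Unset Printing Implicit Defensive.

Import Order.TTheory.
Local Open Scope order_scope.
Local Open Scope classical_set_scope.
Local Open Scope card_scope.

(* The ground model V is the cumulative hierarchy of well-founded trees, with
   the set {f a | a : A} represented by [vset f]. The same set has many
   representations, so equality of sets is [veq] and not Leibniz equality. *)
Inductive V : Type := vset (A : Type) (f : A -> V).

Definition vidx (x : V) : Type := match x return Type with vset A _ => A end.
Definition velt (x : V) : vidx x -> V :=
  match x return vidx x -> V with vset _ f => f end.

Fixpoint veq (x y : V) : Prop :=
  match x, y with
  | vset A f, vset B g =>
      (forall a, exists b, veq (f a) (g b)) /\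
      (forall b, exists a, veq (f a) (g b))
  end.

Definition vmem (x y : V) : Prop := exists a : vidx y, veq x (velt a).

Definition members (x : V) : set V := [set y | vmem y x].

(* Sizes are counted up to [veq] (resp. [name_eq] below): [modulo E S] is the
   set of E-classes of the elements of S. *)
Definition modulo (T : Type) (E : T -> T -> Prop) (S : set T) : set (set T) :=
  (fun x => E x : set T) @` S.

Definition vcard (x : V) : set (set V) := modulo veq (members x).

(* The type T has the size of a set of V. The types that index sets of V are
   strictly smaller than the types on which library structures live, so this
   has to be required of a forcing. *)
Definition set_sized (T : Type) : Prop := exists x : V, [set: T] #<= vcard x.

Definition vempty : V := vset (fun e : Empty_set => match e with end).

Definition vsucc (x : V) : V :=
  vset (fun o : option (vidx x) => if o is Some a then velt a else x).

Definition vunion (I : Type) (F : I -> V) : V :=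
  vset (fun w : {i : I & vidx (F i)} => velt (projT2 w)).

Definition vtransitive (x : V) : Prop :=
  forall y, vmem y x -> members y `<=` members x.

Definition vordinal (a : V) : Prop :=
  vtransitive a /\ forall b, vmem b a -> vtransitive b.

(* For ordinals, the order [a <= b] is inclusion. *)
Definition ord_le (a b : V) : Prop := members a `<=` members b.

Definition vcardinal (k : V) : Prop :=
  vordinal k /\ forall b, vmem b k -> ~ (vcard k #<= vcard b).

(* H_{kappa^+} *)
Fixpoint Hplus (kappa x : V) : Prop :=
  match x with
  | vset A f => vcard x #<= vcard kappa /\ forall a, Hplus kappa (f a)
  end.

(* P^alpha(X), as the collection of its elements. *)
Fixpoint iter_pow (X alpha : V) : set V :=
  match alpha with
  | vset A f =>
      if pselect (inhabited A)
      then [set y | members y `<=` \bigcup_a iter_pow X (f a)]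
      else members X
  end.

(* P^{<alpha}(X) *)
Definition iter_pow_lt (X alpha : V) : set V :=
  \bigcup_(a : vidx alpha) iter_pow X (velt a).

(* The forcing consisting of the nonzero elements of a Boolean algebra; it has
   a largest element since the algebra is nontrivial. *)
Definition nonzero d (B : ctbDistrLatticeType d)
  (nontriv : (\top : B) != \bot) : Type := {p : B | p != \bot}.

HB.instance Definition _ d (B : ctbDistrLatticeType d) nontriv :=
  SubChoice.on (@nonzero d B nontriv).
HB.instance Definition _ d (B : ctbDistrLatticeType d) nontriv :=
  [SubChoice_isSubPOrder of @nonzero d B nontriv by <: with d].

Lemma nonzero_le_top d (B : ctbDistrLatticeType d) nontriv
  (p : @nonzero d B nontriv) :
  p <= (exist _ \top nontriv : @nonzero d B nontriv).
Proof. exact: lex1. Qed.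

HB.instance Definition _ d (B : ctbDistrLatticeType d) nontriv :=
  @Order.hasTop.Build d (@nonzero d B nontriv) _ (@nonzero_le_top d B nontriv).

Definition predense d (P : porderType d) (D : set P) : Prop :=
  forall p, exists2 q, D q & exists r, r <= p /\ r <= q.

Definition is_filter d (P : porderType d) (g : set P) : Prop :=
  [/\ g !=set0,
      forall p q, g p -> p <= q -> g q
    & forall p q, g p -> g q -> exists2 r, g r & r <= p /\ r <= q].

(* The requirement on [D] says that [D gamma] depends on the set gamma only,
   and not on its representation. *)
Definition BFA d (P : porderType d) (lam kappa : V) : Prop :=
  forall D : V -> set P,
    (forall gamma delta, veq gamma delta -> D gamma = D delta) ->
    (forall gamma, vmem gamma kappa ->
       predense (D gamma) /\ D gamma #<= vcard lam) ->
    exists2 g : set P, is_filter g &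
      forall gamma, vmem gamma kappa -> (g `&` D gamma) !=set0.

(* [Name s c] is the name {(s i, c i) | i : I}; as for sets, equality of names
   is not Leibniz equality but [name_eq]. *)
Inductive name (P : Type) : Type :=
  Name (I : Type) (s : I -> name P) (c : I -> P).

Definition nidx (P : Type) (s : name P) : Type :=
  match s return Type with Name K _ _ => K end.
Definition nsub (P : Type) (s : name P) : nidx s -> name P :=
  match s return nidx s -> name P with Name _ t _ => t end.
Definition ncond (P : Type) (s : name P) : nidx s -> P :=
  match s return nidx s -> P with Name _ _ c => c end.

Fixpoint name_eq (P : Type) (s t : name P) : Prop :=
  match s, t with
  | Name K si ci, Name J tj dj =>
      (forall i, exists j, name_eq (si i) (tj j) /\ ci i = dj j) /\
      (forall j, exists i, name_eq (si i) (tj j) /\ ci i = dj j)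
  end.

(* (t, p) \in s *)
Definition name_mem (P : Type) (t : name P) (p : P) (s : name P) : Prop :=
  exists i : nidx s, name_eq t (nsub i) /\ ncond i = p.

Definition name_dom (P : Type) (s : name P) : set (name P) :=
  [set t | exists p, name_mem t p s].

Fixpoint check d (P : tPOrderType d) (x : V) : name P :=
  match x with vset A f => Name (fun a => check P (f a)) (fun=> \top) end.

Fixpoint eval (P : Type) (g : set P) (s : name P) : V :=
  match s with
  | Name K si ci => vset (fun i : {i : K | g (ci i)} => eval g (si (sval i)))
  end.

Definition is_check_in d (P : tPOrderType d) (X : V) (s : name P) : Prop :=
  exists2 x, vmem x X & name_eq s (check P x).

(* The rank of [s] as an X-name. *)
Fixpoint name_rank d (P : tPOrderType d) (X : V) (s : name P) : V :=
  match s with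
  | Name K si _ =>
      if pselect (is_check_in X s) then vempty
      else vunion (fun i => vsucc (name_rank X (si i)))
  end.

Definition locally_small (P : Type) (kappa : V) (s : name P) : Prop :=
  modulo (@name_eq P) (name_dom s) #<= vcard kappa.

Fixpoint name_small (P : Type) (kappa : V) (s : name P) : Prop :=
  match s with
  | Name K si _ => locally_small kappa s /\ forall i, name_small kappa (si i)
  end.

Definition locally_bounded (P : Type) (lam : V) (s : name P) : Prop :=
  exists (T : set (name P)) (S : name P -> set P),
    (forall t p, name_mem t p s <-> T t /\ S t p) /\
    (forall t, T t -> S t #<= vcard lam).

Fixpoint name_bounded (P : Type) (lam : V) (s : name P) : Prop :=
  match s with
  | Name K si _ => locally_bounded lam s /\ forall i, name_bounded lam (si i)
  end.

Definition dense_below d (P : porderType d) (D : set P) (p : P) : Prop :=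
  forall q, q <= p -> exists2 r, r <= q & D r.

(* p ||- s = t, by the usual recursion: every q <= p, c with (u, c) \in s
   forces u \in t, and symmetrically. Both halves call the relation on a
   subname of [s] first, hence u = v rather than v = u in the second one. *)
Fixpoint forces_eq d (P : porderType d) (s t : name P) (p : P) : Prop :=
  match s, t with
  | Name K si ci, Name J tj dj =>
      (forall i q, q <= p -> q <= ci i ->
         dense_below
           [set r | exists j, r <= dj j /\ forces_eq (si i) (tj j) r] q) /\
      (forall j q, q <= p -> q <= dj j ->
         dense_below
           [set r | exists i, r <= ci i /\ forces_eq (si i) (tj j) r] q)
  end.

Definition forces_mem d (P : porderType d) (s t : name P) (p : P) : Prop :=
  dense_below
    [set r | exists j : nidx t, r <= ncond j /\ forces_eq s (nsub j) r] p.

(* Sigma_0-formulas with free variables v_0, ..., v_(n-1). [FEx i phi] is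
   (exists x \in v_i) phi, where in [phi] the variable 0 is x and v_j is
   renumbered j+1. Other connectives and the bounded universal quantifier are
   the usual classical abbreviations. *)
Inductive formula : nat -> Type :=
| FEq n (i j : 'I_n) : formula n
| FMem n (i j : 'I_n) : formula n
| FNot n (phi : formula n) : formula n
| FAnd n (phi psi : formula n) : formula n
| FEx n (i : 'I_n) (phi : formula n.+1) : formula n.

Definition env_cons (T : Type) n (x : T) (e : 'I_n -> T) : 'I_n.+1 -> T :=
  fun i => if unlift ord0 i is Some j then e j else x.

Fixpoint sat n (phi : formula n) : ('I_n -> V) -> Prop :=
  match phi with
  | FEq _ i j => fun e => veq (e i) (e j)
  | FMem _ i j => fun e => vmem (e i) (e j)
  | FNot _ psi => fun e => ~ sat psi e
  | FAnd _ psi chi => fun e => sat psi e /\ sat chi e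
  | FEx _ i psi => fun e => exists2 x, vmem x (e i) & sat psi (env_cons x e)
  end.

Fixpoint forces d (P : porderType d) n (phi : formula n) :
    ('I_n -> name P) -> P -> Prop :=
  match phi with
  | FEq _ i j => fun e p => forces_eq (e i) (e j) p
  | FMem _ i j => fun e p => forces_mem (e i) (e j) p
  | FNot _ psi => fun e p => forall q, q <= p -> ~ forces psi e q
  | FAnd _ psi chi => fun e p => forces psi e p /\ forces chi e p
  | FEx _ i psi => fun e p =>
      dense_below [set r | exists2 x : name P,
        forces_mem x (e i) r & forces psi (env_cons x e) r] p
  end.

Definition BN d (P : tPOrderType d) (lam X kappa alpha : V) : Prop :=
  forall (s : name P) (A : V),
    name_small kappa s -> name_bounded lam s -> ord_le (name_rank X s) alpha ->
    Hplus kappa A -> iter_pow X alpha A ->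
    forces_eq s (check P A) \top ->
    exists2 g : set P, is_filter g & veq (eval g s) A.

Definition BN_inf d (P : tPOrderType d) (lam kappa : V) : Prop :=
  forall alpha X, vordinal alpha -> vtransitive X -> Hplus kappa X ->
    BN P lam X kappa alpha.

Definition S0BN d (P : tPOrderType d) (lam X kappa alpha : V) : Prop :=
  forall n (s : 'I_n.+1 -> name P),
    (forall i, [/\ name_small kappa (s i), name_bounded lam (s i)
                 & ord_le (name_rank X (s i)) alpha]) ->
    exists2 g : set P, is_filter g &
      forall phi : formula n.+1, forces phi s \top ->
        sat phi (fun i => eval g (s i)).

Definition S0BN_inf d (P : tPOrderType d) (lam kappa : V) : Prop :=
  forall n (s : 'I_n.+1 -> name P),
    (exists X, [/\ vtransitive X, Hplus kappa X &
       forall i, [/\ name_small kappa (s i), name_bounded lam (s i)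
         & exists2 alpha, vordinal alpha & ord_le (name_rank X (s i)) alpha]]) ->
    exists2 g : set P, is_filter g &
      forall phi : formula n.+1, forces phi s \top ->
        sat phi (fun i => eval g (s i)).

(* Main.v *)
Require Import Defs.
From mathcomp Require Import all_boot all_order.
From mathcomp Require Import boolp classical_sets functions cardinality.

(** A Sigma_0 statement about names only concerns the names themselves and their
    hereditary subnames. There are at most kappa of these up to equality (or
    countably many, if kappa is finite), and so at most as many Sigma_0
    statements about them. Hence a filter is as good as a generic one for these
    statements as soon as it meets as many suitable predense sets. For each name
    t and each statement R with a parameter that ranges over t, it has to decide
    whether some element of t satisfies R and, if so, to choose a witness: the
    predense set consists of the Boolean values of R at the elements of t,
    together with the complement of their supremum. It has at most kappa + 1
    elements, which is where kappa <= lambda is used. In addition, for each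
    element u of t, the filter has to contain one of the conditions with which u
    occurs in t, or to force that there is none in the generic filter; here the
    size is at most lambda + 1 because t is bounded. Such families are handled
    by [settles_predense] and [BFA_settling_codes]. That truth and forcing agree
    along such a filter is proved by induction ([truth_eq], [truth]), where the
    only real step is [matched_forces_ex] for the existential quantifier.
    A finite kappa has no room for the infinitely many statements; but then there
    are only countably many requirements, and the Rasiowa-Sikorski construction
    meets these in any forcing.

    A name that is forced to be equal to A is evaluated to A by a filter along
    which the Sigma_0 statement v_0 = v_1 is correct about this name and the
    canonical name of A ([eval_eq_of_truth]).

    For the converse, let x be an injection of kappa into P^{<alpha}(X). The name
    {(check x_gamma, p) | p in D_gamma} is forced to be {x_gamma | gamma < kappa},
    as the D_gamma are predense, and a filter that gives it this value meets all
    of them ([BN_BFA]). The x_gamma have to be hereditarily of size at most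
    kappa; this is arranged by [iter_pow_lt_Hplus], which chooses them at the
    first stage of the iterated power sets that has size at least kappa. *)

Set Implicit Arguments.
Unset Strict Implicit.
Unset Printing Implicit Defensive.

Import Order.Theory.
Local Open Scope order_scope.
Local Open Scope classical_set_scope.
Local Open Scope card_scope.

(** * Cardinal arithmetic *)

Definition embeds (T U : Type) : Prop := exists f : T -> U, injective f.

Lemma card_leE T U (A : set T) (B : set U) :
  (A #<= B) = embeds (set_type A) (set_type B) :> Prop.
Proof.
apply/propext; split=> [/card_leP/injfunPex[f _ fI]|[f fI]].
  by exists f => x y; apply: fI; rewrite in_setT.
by apply/card_leP/injfunPex; exists f => // x y _ _; exact: fI.
Qed.

Lemma card_leW T (U : pointedType) (A : set T) (B : set U) : A #<= B ->
  exists f : T -> U, (forall x, A x -> B (f x)) /\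
    forall x y, A x -> A y -> f x = f y -> x = y.
Proof.
move=> /pcard_leP/injfunPex[f fAB fI]; exists f; split=> [x /fAB //|x y Ax Ay].
by apply: fI; rewrite inE.
Qed.

Lemma card_le_in T U (A : set T) (B : set U) (f : T -> U) :
  (forall x, A x -> B (f x)) ->
  (forall x y, A x -> A y -> f x = f y -> x = y) -> A #<= B.
Proof.
move=> fAB fI; rewrite card_leE.
have fm (x : A) : f (val x) \in B by case: x => x /= /set_mem Ax; exact/mem_set/fAB.
exists (fun x => exist _ (f (val x)) (fm x)) => -[x Ax] [y Ay] [] /= e.
by apply: val_inj; apply: fI e; exact: set_mem.
Qed.

Lemma card_le_surj T U (A : set T) (B : set U) (f : T -> U) :
  B `<=` f @` A -> B #<= A.
Proof.
by move=> sBfA; apply: card_le_trans (subset_card_le sBfA) (card_image_le f A).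
Qed.

Lemma embeds_refl T : embeds T T.
Proof. by exists id. Qed.

Lemma embeds_trans U T W : embeds T U -> embeds U W -> embeds T W.
Proof. by move=> [f fI] [g gI]; exists (g \o f); exact: inj_comp. Qed.

(** A maximal partial injection is total or onto, for otherwise it could be
    extended by one pair. *)
Lemma embeds_total T U : embeds T U \/ embeds U T.
Proof.
pose P (G : set (T * U)) := forall x y x' y', G (x, y) -> G (x', y') ->
  (x = x' <-> y = y').
have [|G [PG Gmax]] := @Zorn_bigcup _ P.
  move=> F FP Ftot x y x' y' [G1 F1 G1xy] [G2 F2 G2xy].
  have [s12|s21] := Ftot _ _ F1 F2.
    exact: (FP _ F2) (s12 _ G1xy) G2xy.
  exact: (FP _ F1) G1xy (s21 _ G2xy).
have [Gtot|/existsNP[x0 Gx0]] := pselect (forall x, exists y, G (x, y)).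
  left; have [f fG] := choice Gtot.
  by exists f => x x'; exact: (PG _ _ _ _ (fG x) (fG x')).2.
right; have [Gsur|/existsNP[y0 Gy0]] := pselect (forall y, exists x, G (x, y)).
  have [f fG] := choice Gsur.
  by exists f => y y'; exact: (PG _ _ _ _ (fG y) (fG y')).1.
exfalso; apply: (Gmax (G `|` [set (x0, y0)])).
  split=> [|/(_ (x0, y0)) Gxy]; first exact: subsetUl.
  by apply: Gx0; exists y0; apply: Gxy; right.
move=> x y x' y' [Gxy|[-> ->]] [Gxy'|[-> ->]] //.
- exact: PG.
- split=> e; subst; first by case: Gx0; exists y.
  by case: Gy0; exists x.
- split=> e; subst; first by case: Gx0; exists y'.
  by case: Gy0; exists x'.
Qed.

Section Square.
Variable T : Type.

Let field (G : set (T * T * T)) : set T := [set x | exists y z, G (x, y, z)].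

(** [G] relates each pair of elements of its field to a code in its field.
    Codes need not be unique, so that unions of chains cause no trouble. *)
Let pairing (G : set (T * T * T)) : Prop :=
  [/\ forall x y z, G (x, y, z) -> field G y /\ field G z,
      forall x y, field G x -> field G y -> exists z, G (x, y, z)
    & forall x y x' y' z, G (x, y, z) -> G (x', y', z) -> x = x' /\ y = y'].

Let pairing_chain (F : set (set (T * T * T))) :
  F `<=` pairing -> total_on F subset -> pairing (\bigcup_(G in F) G).
Proof.
move=> FP Ftot; split=> [x y z [G FG Gxyz]|x y|].
- have [cl _ _] := FP _ FG.
  have [[y1 [z1 Gy]] [y2 [z2 Gz]]] := cl _ _ _ Gxyz.
  by split; [exists y1, z1; exists G|exists y2, z2; exists G].
- move=> [y1 [z1 [G1 F1 G1x]]] [y2 [z2 [G2 F2 G2y]]].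
  have [s12|s21] := Ftot _ _ F1 F2.
    have [_ tot _] := FP _ F2.
    have [|z Gz] := tot x y _ ltac:(by exists y2, z2).
      by exists y1, z1; exact: s12.
    by exists z; exists G2.
  have [_ tot _] := FP _ F1.
  have [|z Gz] := tot x y ltac:(by exists y1, z1).
    by exists y2, z2; exact: s21.
  by exists z; exists G1.
- move=> x y x' y' z [G1 F1 G1x] [G2 F2 G2x].
  have [s12|s21] := Ftot _ _ F1 F2.
    have [_ _ inj] := FP _ F2; exact: inj (s12 _ G1x) G2x.
  have [_ _ inj] := FP _ F1; exact: inj G1x (s21 _ G2x).
Qed.

(** Zorn's lemma gives a maximal set S with an injection of S * S into S that
    extends a pairing of the natural numbers. If the complement of S embeds in
    S then T embeds in 2 * S, hence in S. Otherwise the complement contains a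
    copy Y of S, and the pairs of elements of S and Y that are not yet coded
    can be coded in Y, against maximality. *)
Lemma embeds_square : embeds nat T -> embeds (T * T) T.
Proof.
move=> [f fI].
pose G0 : set (T * T * T) :=
  [set t | exists i j, t = (f i, f j, f (pickle (i, j)))].
have G0P : pairing G0.
  split=> [x y z [i [j [_ -> ->]]]|x y|x y x' y' z].
  - by split; eexists; eexists; [exists j, 0|exists (pickle (i, j)), 0].
  - move=> [y1 [z1 [i [i' [xi _ _]]]]] [y2 [z2 [j [j' [yj _ _]]]]].
    by exists (f (pickle (i, j))), i, j; rewrite xi yj.
  - move=> [i [j [-> -> ->]]] [i' [j' [-> ->]]] /fI.
    by move=> /(pcan_inj pickleK)[-> ->].
have [|G1 [PG Gmax]] := @Zorn_bigcup _ [set G | pairing (G0 `|` G)].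
  move=> F FP Ftot /=; have -> : G0 `|` \bigcup_(G in F) G =
      \bigcup_(G in G0 |` [set G0 `|` H | H in F]) G.
    apply/seteqP; split=> [t [G0t|[H FH Ht]]|t [_ [->|[H FH <-]]]].
    - by exists G0 => //; left.
    - by exists (G0 `|` H); [right; exists H|right].
    - by left.
    - by case=> [|Ht]; [left|right; exists H].
  apply: pairing_chain => [_ [->//|[H FH <-]]|]; first exact: FP.
  move=> _ _ [->|[H FH <-]] [->|[H' FH' <-]].
  - by left.
  - by left; exact: subsetUl.
  - by right; exact: subsetUl.
  - by have [s|s] := Ftot _ _ FH FH'; [left|right]; exact: setUS.
move: PG Gmax; set G := G0 `|` G1 => -[cl tot inj] Gmax.
have {tot} [m mG] : exists m : T -> T -> T,
    forall x y, field G x -> field G y -> G (x, y, m x y).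
  have /choice[m mG] : forall xy : T * T, exists z,
      field G xy.1 -> field G xy.2 -> G (xy.1, xy.2, z).
    move=> [x y] /=; case: (pselect (field G x /\ field G y)) => [[Sx Sy]|nS].
      by have [z Gz] := tot x y Sx Sy; exists z.
    by exists x => Sx Sy; case: nS.
  by exists (fun x y => m (x, y)) => x y; exact: (mG (x, y)).
have mS x y : field G x -> field G y -> field G (m x y).
  by move=> Sx Sy; have [] := cl _ _ _ (mG _ _ Sx Sy).
have mI x y x' y' : field G x -> field G y -> field G x' -> field G y' ->
    m x y = m x' y' -> x = x' /\ y = y'.
  move=> Sx Sy Sx' Sy' e; apply: inj (mG _ _ Sx Sy) _.
  by rewrite e; exact: mG.
have Sf i : field G (f i).
  by exists (f i), (f (pickle (i, i))); left; exists i, i.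
(* a set is coded in S as soon as its part outside S is: 2 * S embeds in S *)
have code (U : set T) (e : T -> T) :
    (forall x, U x -> ~ field G x -> field G (e x)) ->
    (forall x y, U x -> U y -> ~ field G x -> ~ field G y -> e x = e y ->
       x = y) ->
    exists h : T -> T, (forall x, U x -> field G (h x)) /\
      forall x y, U x -> U y -> h x = h y -> x = y.
  move=> eS eI.
  exists (fun x => if pselect (field G x) then m (f 0) x else m (f 1) (e x)).
  split=> [x Ux|x y Ux Uy].
    by case: pselect => Sx; apply: mS => //; exact: eS.
  case: pselect => Sx; case: pselect => Sy /mI.
  - by move=> -[].
  - by move=> [] //; [exact: eS|move=> /fI].
  - by move=> [] //; [exact: eS|move=> /fI].
  - by move=> [] //; [exact: eS|exact: eS|move=> _; exact: eI].
have [[e eI]|[e eI]] :=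
    embeds_total (set_type (~` field G)) (set_type (field G)).
  pose e' x := if pselect (~ field G x) is left nSx
    then val (e (exist _ x (mem_set (nSx : (~` field G) x)))) else x.
  have [x _|x y _ _ nSx nSy|h [hS hI]] := code setT e'.
  - rewrite /e'; case: pselect => // nSx _; apply: set_mem; exact: valP.
  - rewrite /e'; case: pselect => // {}nSx; case: pselect => // {}nSy.
    by move=> /val_inj/eI[].
  exists (fun xy => m (h xy.1) (h xy.2)) => -[x y] [x' y'] /= /mI[]; try exact: hS.
  by move=> /hI -> // /hI ->.
exfalso.
pose e1 x := if pselect (field G x) is left Sx
  then val (e (exist _ x (mem_set Sx))) else x.
have e1N x : field G x -> ~ field G (e1 x).
  move=> Sx; rewrite /e1; case: pselect => // {}Sx.
  by have /set_mem := valP (e (exist _ x (mem_set Sx))).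
have e1I x y : field G x -> field G y -> e1 x = e1 y -> x = y.
  move=> Sx Sy; rewrite /e1; case: pselect => // {}Sx; case: pselect => // {}Sy.
  by move=> /val_inj/eI[].
pose U := field G `|` (e1 @` field G).
have /choice[e2 e2E] : forall y, exists x,
    (e1 @` field G) y -> field G x /\ e1 x = y.
  move=> y; case: (pselect ((e1 @` field G) y)) => [[x Sx <-]|nY].
    by exists x.
  by exists y.
have [x [Sx nSx //|Yx _]|x y|h [hS hI]] := code U e2.
- by have [] := e2E _ Yx.
- move=> [Sx nSx //|Yx] [Sy ? nSy //|Yy] _ _ e12.
  by rewrite -(e2E _ Yx).2 -(e2E _ Yy).2 e12.
pose G' := G `|` [set t | exists x y, [/\ U x, U y, ~ (field G x /\ field G y)
  & t = (x, y, e1 (m (h x) (h y)))]].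
have SG' x : field G' x <-> U x.
  split=> [[y [z [Gx|[x' [y' [Ux _ _ [-> _ _]]]]]]]//|Ux].
    by left; exists y, z.
  have [Sx|nSx] := pselect (field G x).
    by exists x, (m x x); left; exact: mG.
  by exists x; eexists; right; exists x, x; split=> //; case.
apply: (Gmax G').
  split=> [t G1t|]; first by left; right.
  have nS := e1N _ (Sf 0).
  have Ue : U (e1 (f 0)) by right; exists (f 0).
  have /SG'[y [z Gz]] := Ue.
  by move=> /(_ _ Gz) G1z; apply: nS; exists y, z; right.
rewrite /= (_ : G0 `|` G' = G'); last first.
  by apply/setUidPr => t G0t; left; left.
split=> [x y z|x y|x y x' y' z].
- move=> [Gx|[x' [y' [Ux Uy _ [_ -> ->]]]]].
    by have [Sy Sz] := cl _ _ _ Gx; split; apply/SG'; left.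
  split; apply/SG' => //; right; eexists; last reflexivity.
  by apply: mS; exact: hS.
- move=> /SG' Ux /SG' Uy.
  have [[Sx Sy]|nS] := pselect (field G x /\ field G y).
    by exists (m x y); left; exact: mG.
  by eexists; right; exists x, y.
- have new u v : U u -> U v -> field G (m (h u) (h v)).
    by move=> Uu Uv; apply: mS; exact: hS.
  move=> [Gx|[u [v [Uu Uv _ [-> -> ->]]]]].
    move=> [|[u [v [Uu Uv _ [_ _ ze]]]]]; first exact: inj.
    by have [_] := cl _ _ _ Gx; rewrite ze => /(e1N _ (new _ _ Uu Uv)).
  move=> [Gx|[u' [v' [Uu' Uv' _ [-> ->]]]]].
    by have [_] := cl _ _ _ Gx => /(e1N _ (new _ _ Uu Uv)).
  move=> /e1I => /(_ (new _ _ Uu Uv) (new _ _ Uu' Uv')) /mI[]; try exact: hS.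
  by move=> /hI -> // /hI ->.
Qed.

End Square.

(** The map from [k b] to [h b] respects equality but may be multivalued, so
    that it does not come with a function on representatives; it acts on
    classes. *)
Lemma modulo_le (I T U : Type) (E : T -> T -> Prop) (E' : U -> U -> Prop)
    (S : set T) (S' : set U) (k : I -> T) (h : I -> U) :
  (forall x, E x x) -> (forall x y, E' x y -> E' y x) ->
  (forall y x z, E' x y -> E' y z -> E' x z) ->
  (forall b, S (k b)) -> (forall u, S' u -> exists b, E' u (h b)) ->
  (forall b b', E (k b) (k b') -> E' (h b) (h b')) ->
  modulo E' S' #<= modulo E S.
Proof.
move=> Er Es Et Sk S'h kh.
pose image_class (C : set T) := [set u | exists2 b, C (k b) & E' (h b) u].
apply: (@card_le_surj _ _ _ _ image_class) => _ [u /S'h[b ub] <-].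
exists (E (k b)); first by exists (k b).
apply/seteqP; split=> v; last by move=> uv; exists b => //; exact: (Et _ _ _ (Es _ _ ub)).
by move=> [b' bb' bv]; exact: (Et _ _ _ ub (Et _ _ _ (kh _ _ bb') bv)).
Qed.

Section Codes.
Variable L : Type.
Hypotheses (natL : embeds nat L) (squareL : embeds (L * L) L).

Lemma embeds_prod T U : embeds T L -> embeds U L -> embeds (T * U) L.
Proof.
move=> [f fI] [g gI]; apply: embeds_trans squareL.
by exists (fun x => (f x.1, g x.2)) => -[x y] [x' y'] [/fI -> /gI ->].
Qed.

Lemma embeds_sum T U : embeds T L -> embeds U L -> embeds (T + U) L.
Proof.
move=> [f fI] [g gI]; have [n nI] := natL; apply: embeds_trans squareL.
exists (fun x => match x with inl t => (n 0, f t) | inr u => (n 1, g u) end).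
by move=> [t|u] [t'|u'] /= [] => [/fI ->|/nI|/nI|/gI ->].
Qed.

Lemma embeds_option T : embeds T L -> embeds (option T) L.
Proof.
move=> TL; apply: embeds_trans (embeds_sum TL natL).
by exists (fun x => if x is Some t then inl t else inr 0) => -[x|] [y|] // [->].
Qed.

(** A list is coded as nested pairs, with [n 0] and [n 1] as the tags of the two
   constructors. *)
Lemma embeds_seq T : embeds T L -> embeds (seq T) L.
Proof.
move=> [f fI]; have [n nI] := natL; have [p pI] := squareL.
exists (foldr (fun t c => p (n 1, p (f t, c))) (p (n 0, n 0))).
elim=> [|t s IHs] [|t' s'] //= /pI[] => [/nI//|/nI//|].
by move=> /pI[/fI -> /IHs ->].
Qed.

End Codes.

(** * Sets *)

Lemma veq_refl x : veq x x.
Proof. by elim: x => A f IH; split=> a; exists a. Qed.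

Lemma veq_sym x y : veq x y -> veq y x.
Proof.
elim: x y => A f IH [B g] [fg gf].
by split=> [b|a]; [have [a] := gf b; exists a|have [b] := fg a; exists b]; exact: IH.
Qed.

Lemma veq_trans y x z : veq x y -> veq y z -> veq x z.
Proof.
elim: x y z => A f IH [B g] [C h] [fg gf] [gh hg]; split=> [a|c].
  by have [b fgb] := fg a; have [c ghc] := gh b; exists c; exact: IH ghc.
by have [b ghb] := hg c; have [a fga] := gf b; exists a; exact: IH ghb.
Qed.

Lemma veq_classE x y : (veq x = veq y :> set V) <-> veq x y.
Proof.
split=> [->|xy]; first exact: veq_refl.
by apply/seteqP; split=> z; apply: veq_trans => //; exact: veq_sym.
Qed.

Lemma vmem_velt x (a : vidx x) : vmem (velt a) x.
Proof. by exists a; exact: veq_refl. Qed.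

Lemma vmem_veql x y z : veq x y -> vmem x z -> vmem y z.
Proof. by move=> xy [a xa]; exists a; apply: veq_trans xa; exact: veq_sym. Qed.

Lemma vmemE x y : vmem y x = members x y.
Proof. by []. Qed.

Lemma veqP x y : veq x y <-> members x = members y.
Proof.
split=> [|exy].
  case: x y => [A f] [B g] [fg gf]; apply/seteqP.
  split=> z [a za].
    by have [b fgb] := fg a; exists b; exact: veq_trans fgb.
  by have [b fgb] := gf a; exists b; apply: veq_trans (veq_sym fgb).
have xy z : vmem z x <-> vmem z y by rewrite !vmemE exy.
case: x y {exy} xy => [A f] [B g] fg; split=> [a|b].
  by have /fg[b] := @vmem_velt (vset f) a; exists b.
by have /fg[a /veq_sym] := @vmem_velt (vset g) b; exists a.
Qed.

Lemma vmem_veqr x y z : veq y z -> vmem x y -> vmem x z.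
Proof. by move=> /veqP yz; rewrite !vmemE yz. Qed.

Lemma vmem_ind (Q : V -> Prop) :
  (forall x, (forall y, vmem y x -> Q y) -> Q x) -> forall x, Q x.
Proof.
move=> QI x; suff: forall y, veq y x -> Q y by apply; exact: veq_refl.
elim: x => A f IH y yA; apply: QI => z /(vmem_veqr yA)[a]; exact: IH.
Qed.

Lemma vmem_irrefl x : ~ vmem x x.
Proof. by elim/vmem_ind: x => x IH; move=> xx; exact: IH (xx) xx. Qed.

Lemma vmem_succ x y : vmem y (vsucc x) <-> vmem y x \/ veq y x.
Proof.
split=> [[[a|] ya]|[[a ya]|yx]]; [by left; exists a|by right| |].
  by exists (Some a).
by exists None.
Qed.

Lemma vmem_union (I : Type) (F : I -> V) y :
  vmem y (vunion F) <-> exists i, vmem y (F i).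
Proof. by split=> [[[i a] ya]|[i [a ya]]]; [exists i, a|exists (existT _ i a)]. Qed.

(** ** Ordinals *)

Lemma vordinal_mem a b : vordinal a -> vmem b a -> vordinal b.
Proof. by move=> [at_ ot] ba; split=> [|c cb]; [exact: ot|apply/ot/(at_ b)]. Qed.

Lemma vordinal_trichotomy a b : vordinal a -> vordinal b ->
  [\/ vmem a b, veq a b | vmem b a].
Proof.
elim/vmem_ind: a b => a IHa b; elim/vmem_ind: b => b IHb oa ob.
have [sab|/existsNP[c /not_implyP[ca ncb]]] :=
    pselect (members a `<=` members b); last first.
  have [//|cb|bc] := IHa c ca b (vordinal_mem oa ca) ob.
    by constructor 3; exact: vmem_veql ca.
  by constructor 3; exact: oa.1 ca _ bc.
have [sba|/existsNP[c /not_implyP[cb nca]]] :=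
    pselect (members b `<=` members a); last first.
  have [ac|ac|//] := IHb c cb oa (vordinal_mem ob cb).
    by constructor 1; exact: ob.1 cb _ ac.
  by constructor 1; apply: vmem_veql cb; exact: veq_sym.
by constructor 2; apply/veqP/seteqP.
Qed.

Lemma vordinal_le_mem r b a : vordinal r -> vordinal a -> vmem b a ->
  ord_le r b -> vmem r a.
Proof.
move=> o_r oa ba rb.
have [rb'|rb'|/rb/vmem_irrefl//] := vordinal_trichotomy o_r (vordinal_mem oa ba).
  exact: oa.1 ba _ rb'.
by apply: vmem_veql ba; exact: veq_sym.
Qed.

Lemma vordinal_sup_succ (I : Type) (F : I -> V) :
  (forall i, vordinal (F i)) -> vordinal (vunion (fun i => vsucc (F i))).
Proof.
move=> oF; split=> [y /vmem_union[i /vmem_succ[yF|yF]] z /= zy|y].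
- by apply/vmem_union; exists i; apply/vmem_succ; left; exact: (oF i).1 zy.
- apply/vmem_union; exists i; apply/vmem_succ; left; exact: vmem_veqr zy.
- move=> /vmem_union[i /vmem_succ[yF|/veqP yF]]; first exact: (oF i).2.
  by move=> z zy w wz; rewrite yF; apply: (oF i).1 wz; rewrite vmemE -yF.
Qed.

Lemma ord_le_sup_succ (I : Type) (F : I -> V) a : vordinal a ->
  (forall i, vmem (F i) a) -> ord_le (vunion (fun i => vsucc (F i))) a.
Proof.
move=> oa Fa y /vmem_union[i /vmem_succ[yF|yF]]; first exact: oa.1 (Fa i) _ yF.
by apply: vmem_veql (Fa i); exact: veq_sym.
Qed.

Lemma ord_le_empty a : ord_le vempty a.
Proof. by move=> x [[]]. Qed.

Lemma vordinal_empty : vordinal vempty.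
Proof. by split=> x [[]]. Qed.

Lemma vordinal_succ a : vordinal a -> vordinal (vsucc a).
Proof.
move=> [at_ ot]; split=> [y /vmem_succ[ya|/veqP ya] z zy|
  y /vmem_succ[/ot//|/veqP ya]].
- by apply/vmem_succ; left; exact: at_ ya _ zy.
- by apply/vmem_succ; left; rewrite vmemE -ya.
- by move=> z zy w wz; rewrite ya; apply: at_ wz; rewrite vmemE -ya.
Qed.

(** ** Iterated power sets and hereditary size *)

Lemma iter_pow_zero X a : ~ inhabited (vidx a) -> iter_pow X a = members X.
Proof. by case: a => A f /= A0; case: pselect. Qed.

Lemma iter_pow_pos X a : inhabited (vidx a) ->
  iter_pow X a = [set y | members y `<=` iter_pow_lt X a].
Proof. by case: a => A f /= A0; case: pselect. Qed.

Lemma iter_pow_veq X a b : veq a b -> iter_pow X a = iter_pow X b.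
Proof.
elim: a b => A f IH [B g] ab; have := ab => -[fg gf].
have [A0|A0] := pselect (inhabited A); last first.
  rewrite !iter_pow_zero // => -[b]; apply: A0.
  by have [a _] := gf b; exists.
rewrite !iter_pow_pos //; last first.
  by case: A0 => a; have [b _] := fg a; exists.
suff -> : iter_pow_lt X (vset f) = iter_pow_lt X (vset g) by [].
apply/seteqP; split=> y [a _ /= ya].
  by have [b fgb] := fg a; exists b => //=; rewrite -(IH a (g b)).
by have [b fgb] := gf a; exists b => //=; rewrite (IH b (g a)).
Qed.

Lemma iter_pow_veqr X a x y : veq x y -> iter_pow X a x -> iter_pow X a y.
Proof.
move=> xy; have [a0|a0] := pselect (inhabited (vidx a)).
  by rewrite !iter_pow_pos // /= (veqP x y).1.
by rewrite iter_pow_zero //; exact: vmem_veql.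
Qed.

Lemma iter_pow_ltE X a y :
  iter_pow_lt X a y <-> exists2 b, vmem b a & iter_pow X b y.
Proof.
split=> [[b _ yb]|[b [c bc] yb]].
  by exists (velt b) => //; exact: vmem_velt.
by exists c => //; rewrite -(iter_pow_veq X bc).
Qed.

Lemma iter_pow_lt_sub X a b : ord_le a b -> iter_pow_lt X a `<=` iter_pow_lt X b.
Proof.
by move=> ab y /iter_pow_ltE[c ca yc]; apply/iter_pow_ltE; exists c => //; exact: ab.
Qed.

Lemma vcard_le_members (S : set V) x :
  members x `<=` S -> vcard x #<= modulo veq S.
Proof. by move=> xS; apply: subset_card_le => _ [y /xS Sy <-]; exists y. Qed.

Lemma Hplus_closed kappa (C : set V) :
  (forall y, C y -> vcard y #<= vcard kappa /\ members y `<=` C) ->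
  C `<=` Hplus kappa.
Proof.
move=> CP; elim=> A f IH CA; have [cA sA] := CP _ CA.
by split=> // a; apply/IH/sA; exact: (@vmem_velt (vset f)).
Qed.

Lemma Hplus_transitive kappa X : vtransitive X -> vcard X #<= vcard kappa ->
  Hplus kappa X.
Proof.
move=> tX cX; apply: (@Hplus_closed _ [set y | members y `<=` members X]) => //=.
move=> y yX; split; last by move=> z /yX; exact: tX.
by apply: card_le_trans cX; exact: vcard_le_members.
Qed.

(** Beyond the first stage at which the iterated power sets have reached size
    kappa, their elements may be too big to be hereditarily of size kappa. All
    the earlier stages are smaller than kappa, so the elements of this one are
    small enough. *)
Lemma iter_pow_lt_Hplus kappa X alpha : vordinal alpha -> vtransitive X ->
  vcard X #<= vcard kappa ->
  vcard kappa #<= modulo veq (iter_pow_lt X alpha) ->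
  exists beta, [/\ ord_le beta alpha,
    vcard kappa #<= modulo veq (iter_pow_lt X beta)
    & iter_pow_lt X beta `<=` Hplus kappa].
Proof.
move=> oalpha tX cX; elim/vmem_ind: alpha oalpha => alpha IH oalpha calpha.
have [[b ba cb]|small] := pselect (exists2 b, vmem b alpha &
    vcard kappa #<= modulo veq (iter_pow_lt X b)).
  have [beta [bb cbeta Hbeta]] := IH b ba (vordinal_mem oalpha ba) cb.
  by exists beta; split=> // y /bb; exact: oalpha.1.
exists alpha; split=> //; apply: Hplus_closed => y /iter_pow_ltE[b ba].
have [b0|b0] := pselect (inhabited (vidx b)); last first.
  rewrite (iter_pow_zero _ b0) => yX; split.
    by apply: card_le_trans cX; apply: vcard_le_members => z; exact: tX.
  move=> z zy; apply/iter_pow_ltE; exists b => //.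
  by rewrite (iter_pow_zero _ b0); exact: tX zy.
rewrite iter_pow_pos // => yb; split.
  apply: card_le_trans (vcard_le_members yb) _.
  rewrite card_leE; have [//|/= kb] := embeds_total
    (set_type (modulo veq (iter_pow_lt X b))) (set_type (vcard kappa)).
  by case: small; exists b => //; rewrite card_leE.
by apply: subset_trans yb _; apply: iter_pow_lt_sub => c; exact: oalpha.1.
Qed.

(** * Names *)

Section Names.
Variable P : Type.
Implicit Types s t u : name P.

Lemma name_eq_refl s : name_eq s s.
Proof. by elim: s => I f IH c; split=> i; exists i. Qed.

Lemma name_eq_sym s t : name_eq s t -> name_eq t s.
Proof.
elim: s t => I f IH c [J g d] [fg gf]; split=> [j|i].
  by have [i [fgi cd]] := gf j; exists i; split=> //; exact: IH.
by have [j [fgi cd]] := fg i; exists j; split=> //; exact: IH.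
Qed.

Lemma name_eq_trans t s u : name_eq s t -> name_eq t u -> name_eq s u.
Proof.
elim: s t u => I f IH c [J g d] [K h e] [fg gf] [gh hg]; split=> [i|k].
  have [j [fgj ->]] := fg i; have [k [ghk ->]] := gh j.
  by exists k; split=> //; exact: IH ghk.
have [j [ghj <-]] := hg k; have [i [fgi <-]] := gf j.
by exists i; split=> //; exact: IH ghj.
Qed.

Lemma name_eq_classE s t : (name_eq s = name_eq t :> set (name P)) <-> name_eq s t.
Proof.
split=> [->|st]; first exact: name_eq_refl.
by apply/seteqP; split=> u; apply: name_eq_trans => //; exact: name_eq_sym.
Qed.

Lemma name_mem_nsub s (i : nidx s) : name_mem (nsub i) (ncond i) s.
Proof. by exists i; split=> //; exact: name_eq_refl. Qed.

Lemma locally_smallP kappa s : locally_small kappa s ->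
  exists c : nidx s -> set_type (vcard kappa),
    forall i j, c i = c j <-> name_eq (nsub i) (nsub j).
Proof.
rewrite /locally_small card_leE => -[f fI].
have dom (i : nidx s) : name_eq (nsub i) \in modulo (@name_eq P) (name_dom s).
  by apply/mem_set; exists (nsub i) => //; exists (ncond i); exact: name_mem_nsub.
exists (fun i => f (SigSub (dom i))) => i j; split=> [/fI []|ij].
  by move/name_eq_classE.
by congr f; apply: val_inj; exact/name_eq_classE.
Qed.

Lemma locally_bounded_conds lam s (i : nidx s) : locally_bounded lam s ->
  [set ncond j | j in [set j : nidx s | name_eq (nsub i) (nsub j)]] #<= vcard lam.
Proof.
move=> [T [S [TS cS]]].
have [/cS cSi _] := (TS _ _).1 (name_mem_nsub i).
apply: card_le_trans cSi; apply: subset_card_le => _ [j ij <-].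
by have /TS[] : name_mem (nsub i) (ncond j) s by exists j.
Qed.

Lemma name_small_sub kappa s (i : nidx s) : name_small kappa s ->
  name_small kappa (nsub i).
Proof. by case: s i => I f c i [_]; apply. Qed.

Lemma name_bounded_sub lam s (i : nidx s) : name_bounded lam s ->
  name_bounded lam (nsub i).
Proof. by case: s i => I f c i [_]; apply. Qed.

Lemma name_small_locally kappa s : name_small kappa s -> locally_small kappa s.
Proof. by case: s => I f c []. Qed.

Lemma name_bounded_locally lam s : name_bounded lam s -> locally_bounded lam s.
Proof. by case: s => I f c []. Qed.

Lemma vmem_eval (g : set P) s x : vmem x (eval g s) <->
  exists2 i : nidx s, g (ncond i) & veq x (eval g (nsub i)).
Proof.
case: s => I f c; split=> [[[i gi] /= xi]|[i gi xi]]; first by exists i.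
by exists (exist _ i gi).
Qed.

Lemma eval_name_eq (g : set P) s t : name_eq s t -> veq (eval g s) (eval g t).
Proof.
elim: s t => I f IH c [J h e] [fh hf]; split=> [[i gi]|[j gj]] /=.
  have [j [ij cij]] := fh i; have gj : g (e j) by rewrite -cij.
  by exists (exist _ j gj); exact: IH.
have [i [ij cij]] := hf j; have gi : g (c i) by rewrite cij.
by exists (exist _ i gi); exact: IH.
Qed.

End Names.

(** * Forcing *)

Section Forcing.
Variables (d : Order.disp_t) (P : porderType d).
Implicit Types (p q r : P) (s t u : name P) (D E : set P).

Lemma dense_below_le D p q : q <= p -> dense_below D p -> dense_below D q.
Proof. by move=> qp Dp r rq; apply: Dp; exact: le_trans qp. Qed.

Lemma dense_below_sub D E p : D `<=` E -> dense_below D p -> dense_below E p.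
Proof. by move=> DE Dp q /Dp[r rq /DE Er]; exists r. Qed.

(** Existential quantification over the value of [s], with witnesses among the
    subnames of [s] only. *)
Definition forces_ex s (R : name P -> set P) : set P :=
  dense_below [set r | exists2 i : nidx s, r <= ncond i & R (nsub i) r].

Lemma forces_memE s t p :
  forces_mem s t p <-> forces_ex t (fun u => forces_eq s u) p.
Proof.
by split; apply: dense_below_sub => r [j]; [case=> rj e|move=> rj e]; exists j.
Qed.

Lemma forces_eqE s t p : forces_eq s t p <->
  (forall i q, q <= p -> q <= ncond i -> forces_mem (@nsub _ s i) t q) /\
  (forall j q, q <= p -> q <= ncond j ->
     forces_ex s (fun u => forces_eq u (@nsub _ t j)) q).
Proof.
case: s t => I f c [J g e]; split=> -[fg gf];
  split=> // j q qp qj.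
  by apply: dense_below_sub (gf j q qp qj) => r [i [ri e']]; exists i.
by apply: dense_below_sub (gf j q qp qj) => r [i ri e']; exists i.
Qed.

Lemma forces_eq_le s t p q : q <= p -> forces_eq s t p -> forces_eq s t q.
Proof.
move=> qp /forces_eqE[st ts]; apply/forces_eqE.
by split=> i r rq; [apply: st|apply: ts]; exact: le_trans qp.
Qed.

Lemma name_eq_forces s t p : name_eq s t -> forces_eq s t p.
Proof.
elim: s t p => I f IH c [J g e] p [fg gf]; apply/forces_eqE.
split=> [i|j] q qp /= qc r rq.
  have [j [ij cij]] := fg i; exists r => //; exists j; split; last exact: IH.
  by rewrite /= -cij; exact: le_trans qc.
have [i [ij cij]] := gf j; exists r => //; exists i; last exact: IH.
by rewrite /= cij; exact: le_trans qc.
Qed.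

Lemma forces_eq_refl s p : forces_eq s s p.
Proof. exact/name_eq_forces/name_eq_refl. Qed.

Lemma forces_eq_sym s t p : forces_eq s t p -> forces_eq t s p.
Proof.
elim: s t p => I f IH c [J g e] p /forces_eqE[fg gf]; apply/forces_eqE.
split=> [j|i] q qp qc.
  apply: dense_below_sub (gf j q qp qc) => r [i ri ij].
  by exists i; split=> //; exact: IH.
by apply: dense_below_sub (fg i q qp qc) => r [j [rj ij]]; exists j => //; exact: IH.
Qed.

Lemma forces_eq_trans t s u p :
  forces_eq s t p -> forces_eq t u p -> forces_eq s u p.
Proof.
elim: s t u p => I f IH c t u p /forces_eqE[st ts] /forces_eqE[tu ut].
apply/forces_eqE; split=> [i|k] q qp qc q' q'q.
  have [r rq' [j [rj ij]]] := st i q qp qc q' q'q.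
  have rp : r <= p by apply: le_trans rq' (le_trans q'q qp).
  have [r' r'r [k [r'k jk]]] := tu j r rp rj r (lexx r).
  exists r'; first exact: le_trans rq'.
  by exists k; split=> //; apply: IH jk; exact: forces_eq_le ij.
have [r rq' [j rj jk]] := ut k q qp qc q' q'q.
have rp : r <= p by apply: le_trans rq' (le_trans q'q qp).
have [r' r'r [i r'i ij]] := ts j r rp rj r (lexx r).
exists r'; first exact: le_trans rq'.
by exists i => //; apply: IH ij _; exact: forces_eq_le jk.
Qed.

Lemma forces_mem_le s t p q : q <= p -> forces_mem s t p -> forces_mem s t q.
Proof. exact: dense_below_le. Qed.

Lemma forces_mem_congr s s' t t' p : forces_eq s s' p -> forces_eq t t' p ->
  forces_mem s t p -> forces_mem s' t' p.
Proof.
move=> ss' /forces_eqE[tt' _] st q qp.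
have [r rq [j [rj sj]]] := st q qp; have rp := le_trans rq qp.
have [r' r'r [k [r'k jk]]] := tt' j r rp rj r (lexx r).
exists r'; first exact: le_trans rq.
exists k; split=> //; apply: forces_eq_trans jk.
apply: forces_eq_le r'r _; apply: forces_eq_trans sj; apply: forces_eq_sym.
exact: forces_eq_le ss'.
Qed.

Lemma forces_le n (phi : formula n) e p q :
  q <= p -> forces phi e p -> forces phi e q.
Proof.
elim: phi e => [m i j|m i j|m psi IH|m psi IHpsi chi IHchi|m i psi IH] e qp /=.
- exact: forces_eq_le.
- exact: forces_mem_le.
- by move=> npsi r rq; apply: npsi; exact: le_trans qp.
- by move=> [/IHpsi ? /IHchi ?]; split; auto.
- exact: dense_below_le.
Qed.

Lemma env_cons_congr T (R : T -> T -> Prop) n x x' (e e' : 'I_n -> T) :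
  R x x' -> (forall i, R (e i) (e' i)) ->
  forall i, R (env_cons x e i) (env_cons x' e' i).
Proof. by move=> xx' ee' i; rewrite /env_cons; case: unlift. Qed.

Lemma forces_congr n (phi : formula n) e e' p :
  (forall i, forces_eq (e i) (e' i) p) -> forces phi e p -> forces phi e' p.
Proof.
elim: phi e e' p => [m i j|m i j|m psi IH|m psi IHpsi chi IHchi|m i psi IH]
    e e' p ee' /=.
- move=> ij; apply: forces_eq_trans (ee' j); apply: forces_eq_trans ij.
  exact: forces_eq_sym.
- exact: forces_mem_congr.
- move=> npsi q qp psiq; apply: (npsi q qp); apply: IH psiq => i.
  by apply: forces_eq_sym; exact: forces_eq_le qp (ee' i).
- by move=> [psip chip]; split; [exact: IHpsi psip|exact: IHchi chip].
- move=> ex q qp; have [r rq [x xi psir]] := ex q qp.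
  have ee'r j : forces_eq (e j) (e' j) r.
    exact: forces_eq_le (le_trans rq qp) (ee' j).
  exists r => //; exists x.
    by apply: forces_mem_congr xi; [exact: forces_eq_refl|].
  apply: IH psir; apply: (env_cons_congr (R := fun s t => forces_eq s t r)) => //.
  exact: forces_eq_refl.
Qed.

Lemma forces_congr_cons n (phi : formula n.+1) e s t p :
  forces_eq s t p -> forces phi (env_cons s e) p -> forces phi (env_cons t e) p.
Proof.
move=> st; apply: forces_congr.
apply: (env_cons_congr (R := fun s t => forces_eq s t p)) => // i.
exact: forces_eq_refl.
Qed.

(** An arbitrary name that is forced to be in [e i] is densely forced to be
    equal to a subname of [e i]. So the truth of Sigma_0 formulas only depends
    on the hereditary subnames of their parameters. *)
Lemma forces_FEx n (phi : formula n.+1) (i : 'I_n) e p :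
  forces (FEx i phi) e p <-> forces_ex (e i) (fun u => forces phi (env_cons u e)) p.
Proof.
split=> ex q qp; have [r rq] := ex q qp.
  move=> [x xi phir]; have [r' r'r [j [r'j xj]]] := xi r (lexx r).
  exists r'; first exact: le_trans rq.
  by exists j => //; apply: forces_congr_cons xj _; exact: forces_le phir.
move=> [j rj phir]; exists r => //; exists (nsub j) => // r' r'r.
by exists r' => //; exists j; split; [exact: le_trans rj|exact: forces_eq_refl].
Qed.

End Forcing.

Lemma sat_congr n (phi : formula n) e e' :
  (forall i, veq (e i) (e' i)) -> sat phi e -> sat phi e'.
Proof.
elim: phi e e' => [m i j|m i j|m psi IH|m psi IHpsi chi IHchi|m i psi IH]
    e e' ee' /=.
- move=> ij; apply: veq_trans (ee' j); apply: veq_trans ij; exact: veq_sym.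
- move=> ij; apply: vmem_veqr (ee' j) _; exact: vmem_veql ij.
- by move=> npsi /IH psi'; apply/npsi/psi' => i; exact: veq_sym.
- by move=> [psie chie]; split; [exact: IHpsi psie|exact: IHchi chie].
- move=> [x xi psix]; exists x; first exact: vmem_veqr (ee' i) _.
  by apply: IH psix; apply: (env_cons_congr (R := veq)) => //; exact: veq_refl.
Qed.

(** * Canonical names of sets *)

Section Check.
Variables (d : Order.disp_t) (P : tPOrderType d).
Implicit Types (X kappa lam alpha x y : V).

Lemma check_eq x y : name_eq (check P x) (check P y) <-> veq x y.
Proof.
elim: x y => A f IH [B g]; split=> -[fg gf]; split=> [a|b].
- by have [b [/IH]] := fg a; exists b.
- by have [a [/IH]] := gf b; exists a.
- by have [b /IH] := fg a; exists b.
- by have [a /IH] := gf b; exists a.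
Qed.

Lemma eval_check (g : set P) x : g \top -> veq (eval g (check P x)) x.
Proof.
move=> gT; elim: x => A f IH; split=> [[a ga]|a]; first by exists a; exact: IH.
by exists (exist _ a gT); exact: IH.
Qed.

Lemma check_small kappa x : Hplus kappa x -> name_small kappa (check P x).
Proof.
elim: x => A f IH [cA Hf]; split; last by move=> a; exact/IH/Hf.
apply: card_le_trans cA.
apply: (modulo_le (k := f) (h := check P \o f) veq_refl
  (@name_eq_sym _) (@name_eq_trans _)) => [a|t [p [a [ta _]]]|a b].
- exact: (@vmem_velt (vset f)).
- by exists a.
- by move=> ab; exact/check_eq.
Qed.

Lemma check_bounded lam x : vcard lam !=set0 -> name_bounded lam (check P x).
Proof.
move=> [C0 lamC0]; elim: x => A f IH; split; last exact: IH.
exists [set t | exists a, name_eq t (check P (f a))], (fun=> [set \top]).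
split=> [t p|t _].
  split=> [[a [ta <-]]|[[a ta] ->]]; first by split=> //; exists a.
  by exists a.
by apply: (@card_le_in _ _ _ _ (fun=> C0)) => // x y -> ->.
Qed.

Lemma name_rank_ordinal X (s : name P) : vordinal (name_rank X s).
Proof.
elim: s => I f IH c /=; case: pselect => [?|?]; first exact: vordinal_empty.
exact: vordinal_sup_succ.
Qed.

Lemma name_rank_le X alpha (s : name P) : vordinal alpha ->
  (forall i, exists2 b, vmem b alpha & ord_le (name_rank X (@nsub _ s i)) b) ->
  ord_le (name_rank X s) alpha.
Proof.
case: s => I f c oalpha fb /=; case: pselect => [?|?]; first exact: ord_le_empty.
apply: ord_le_sup_succ => // i; have [b balpha fib] := fb i.
by apply: vordinal_le_mem balpha fib => //; exact: name_rank_ordinal.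
Qed.

Lemma check_rank X alpha x : vordinal alpha -> iter_pow X alpha x ->
  ord_le (name_rank X (check P x)) alpha.
Proof.
elim: x alpha => A f IH alpha oalpha.
have [a0|a0] := pselect (inhabited (vidx alpha)); last first.
  rewrite iter_pow_zero //= => xX; case: pselect => [?|]; first exact: ord_le_empty.
  by case; exists (vset f) => //; exact: name_eq_refl.
rewrite iter_pow_pos // => fX; apply: name_rank_le => // a.
have /fX/iter_pow_ltE[b balpha fab] := @vmem_velt (vset f) a.
by exists b => //; apply: IH => //; exact: vordinal_mem balpha.
Qed.

End Check.

(** * Filters that settle families of conditions *)

Section Filters.
Variables (d : Order.disp_t) (P : tPOrderType d).

Lemma filter_top (g : set P) : is_filter g -> g \top.
Proof. by move=> [[p gp] up _]; apply: up gp _; exact: lex1. Qed.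

Lemma filter_exists : exists g : set P, is_filter g.
Proof.
exists [set p | \top <= p]; split=> [|p q tp pq|p q tp tq].
- by exists \top => /=.
- exact: le_trans pq.
- by exists \top; [exact: lexx|].
Qed.

End Filters.

Section Settling.
Variables (d : Order.disp_t) (P : porderType d).
Implicit Types (p q r : P) (Q : set P) (F : set (set P)).

Definition down_closed Q := forall p q, q <= p -> Q p -> Q q.

(** Below [p] it is decided whether the generic filter meets some member of [F]
    and, if so, which one. *)
Definition settles F : set P := [set p |
  (exists2 Q, F Q & dense_below Q p) \/ (forall Q q, F Q -> q <= p -> ~ Q q)].

Lemma settles_dense F p : F `<=` down_closed -> exists2 q, q <= p & settles F q.
Proof.
move=> dF; have [[Q [q [FQ qp Qq]]]|none] :=
    pselect (exists Q q, [/\ F Q, q <= p & Q q]).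
  exists q => //; left; exists Q => // r rq.
  by exists r => //; exact: dF Qq.
by exists p => //; right=> Q q FQ qp Qq; apply: none; exists Q, q.
Qed.

(** The Rasiowa-Sikorski construction: a descending sequence enters the
    countably many dense sets one by one, and generates the filter. *)
Lemma countable_settling (J : Type) (F : J -> set (set P)) : inhabited P ->
  embeds J nat -> (forall j, F j `<=` down_closed) ->
  exists2 g : set P, is_filter g & forall j, g `&` settles (F j) !=set0.
Proof.
move=> [p0] [h hI] dF.
have /choice[next nextP] : forall np : nat * P, exists q,
    q <= np.2 /\ forall j, h j = np.1 -> settles (F j) q.
  move=> [n p] /=; have [[j jn]|nj] := pselect (exists j, h j = n).
    have [q qp sq] := settles_dense p (dF j); exists q; split=> // j' j'n.
    by have -> : j' = j by apply: hI; rewrite jn.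
  by exists p; split=> // j jn; case: nj; exists j.
pose fix a n := if n is n'.+1 then next (n', a n') else p0.
have ale m n : (m <= n)%N -> a n <= a m.
  elim: n => [|n IHn]; first by rewrite leqn0 => /eqP->.
  rewrite leq_eqVlt ltnS => /orP[/eqP->//|/IHn]; apply: le_trans.
  exact: (nextP (n, a n)).1.
exists [set q | exists n, a n <= q].
  split=> [|p q [n anp] pq|p q [m amp] [n anq]].
  - by exists p0, 0.
  - by exists n; exact: le_trans pq.
  - exists (a (maxn m n)); first by exists (maxn m n).
    by split; [apply: le_trans amp|apply: le_trans anq]; apply: ale;
      rewrite (leq_maxl, leq_maxr).
move=> j; exists (a (h j).+1); split; first by exists (h j).+1.
exact: (nextP (h j, a (h j))).2.
Qed.

End Settling.

(** Only in such a forcing does settling a family of the sets below [c], for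
    various [c], put one of these conditions [c] themselves into the filter. *)
Definition separative d (P : porderType d) : Prop :=
  forall p c : P, dense_below [set r | r <= c] p -> p <= c.

Section Boolean.
Variables (d : Order.disp_t) (B : ctbDistrLatticeType d).
Variable nontriv : (\top : B) != \bot.
Hypothesis complete : forall S : set B, supremums S !=set0.
Let P := nonzero nontriv.
Implicit Types (p q r : P) (Q : set P) (F : set (set P)).

Lemma nonzero_leE p q : (p <= q) = (val p <= val q).
Proof. by []. Qed.

Lemma nonzero_compat (x y : B) : ~ (x <= ~` y)%O ->
  exists p, val p <= x /\ val p <= y.
Proof.
move=> /negP; rewrite -disj_leC => xy.
by exists (Sub (x `&` y)%O xy); rewrite SubK leIl leIr.
Qed.

Lemma nonzero_le_compl p (x : B) : ~ (val p <= x /\ val p <= ~` x)%O.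
Proof.
move=> /andP; rewrite -lexI meetxC lex0 => /eqP p0.
by have := valP p; rewrite p0 eqxx.
Qed.

Lemma nonzero_separative : separative P.
Proof.
move=> p c pc; rewrite nonzero_leE -[val c]complK.
apply: contrapT => /nonzero_compat[q [qp qc]].
have [r rq rc] := pc q qp.
by apply: (@nonzero_le_compl r (val c)); split=> //; exact: le_trans qc.
Qed.

Definition sup (S : set B) : B := projT1 (cid (complete S)).

Lemma sup_ub (S : set B) x : S x -> x <= sup S.
Proof. by rewrite /sup; case: cid => b [ub _] /= /ub. Qed.

Lemma sup_le (S : set B) y : (forall x, S x -> x <= y) -> sup S <= y.
Proof. by rewrite /sup; case: cid => b [_ lb] /= Sy; apply: lb => x /Sy. Qed.

(** The suprema of the members of [F], together with the complement of the
    supremum of all of them, form a predense set. This has only one element more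
    than [F], whereas the dense set [settles F] may be as large as the forcing. *)
Lemma settles_predense lam F : embeds nat (set_type (vcard lam)) ->
  F `<=` @down_closed _ P -> F #<= vcard lam ->
  exists D, [/\ predense D, D #<= vcard lam & D `<=` settles F].
Proof.
move=> nlam dF cF.
pose bval Q : B := sup [set val p | p in Q].
pose bsup : B := sup [set val p | p in \bigcup_(Q in F) Q].
have bvalE Q p : F Q -> val p <= bval Q -> dense_below Q p.
  move=> FQ pQ q qp.
  have [q' [r [Qq' rq rq']]] : exists q' r, [/\ Q q', r <= q & r <= q'].
    apply: contrapT => none; apply: (@nonzero_le_compl q (val q)).
    split=> //; apply: (le_trans (qp : val q <= val p)); apply: le_trans pQ _.
    apply: sup_le.
    move=> _ [q' Qq' <-]; apply: contrapT => /nonzero_compat[r [rq' rq]].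
    by apply: none; exists q', r.
  by exists r => //; exact: dF FQ _ _ rq' Qq'.
have bsupE Q q p : F Q -> val p <= (~` bsup)%O -> q <= p -> ~ Q q.
  move=> FQ pN qp Qq; apply: (@nonzero_le_compl q bsup).
  by split; [apply: sup_ub; exists q => //; exists Q|exact: le_trans pN].
exists [set p | (exists2 Q, F Q & val p = bval Q) \/ val p = (~` bsup)%O]; split.
- move=> p; have [[Q [q [FQ qp qQ]]]|none] :=
      pselect (exists Q q, [/\ F Q, q <= p & val q <= bval Q]).
    have bQ0 : bval Q != \bot.
      by apply: contraNneq (valP q) => bQ0; move: qQ; rewrite bQ0 lex0.
    by exists (Sub (bval Q) bQ0); [left; exists Q|exists q].
  have pN : val p <= (~` bsup)%O.
    rewrite lexC; apply: sup_le => _ [q [Q FQ Qq] <-].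
    apply: contrapT => /nonzero_compat[r [rq rp]].
    apply: none; exists Q, r; split=> //; apply: sup_ub.
    by exists r => //; exact: dF FQ _ _ rq Qq.
  have bN0 : (~` bsup)%O != \bot.
    by apply: contraNneq (valP p) => bN0; move: pN; rewrite bN0 lex0.
  by exists (Sub (~` bsup)%O bN0); [right|exists p].
- pose cond (o : option (set_type F)) : P :=
    insubd (\top : P) (if o is Some Q then bval (val Q) else (~` bsup)%O).
  have cD : [set: option (set_type F)] #<= vcard lam.
    rewrite card_leE; move: cF; rewrite card_leE => cF.
    apply: embeds_trans (embeds_option nlam (embeds_square nlam) cF).
    by exists val => x y; exact: val_inj.
  apply: card_le_trans cD; apply: (@card_le_surj _ _ _ _ cond).
  move=> p [[Q FQ pQ]|pN].
    exists (Some (SigSub (mem_set FQ))) => //.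
    by apply: val_inj; rewrite /cond /= -pQ valKd.
  by exists None => //; apply: val_inj; rewrite /cond -pN valKd.
- move=> p [[Q FQ pQ]|pN]; [left; exists Q => //|right=> Q q FQ].
    by apply: bvalE => //; rewrite pQ.
  by apply: bsupE => //; rewrite pN.
Qed.

Lemma BFA_settling lam kappa (J : Type) (F : J -> set (set P)) :
  ord_le kappa lam -> embeds nat (set_type (vcard kappa)) ->
  BFA P lam kappa -> embeds J (set_type (vcard kappa)) ->
  (forall j, F j `<=` @down_closed _ P) -> (forall j, F j #<= vcard lam) ->
  exists2 g : set P, is_filter g & forall j, g `&` settles (F j) !=set0.
Proof.
move=> kl nkappa bfa [h hI] dF cF.
have nlam : embeds nat (set_type (vcard lam)).
  apply: embeds_trans nkappa _; rewrite -card_leE.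
  by apply: vcard_le_members => x /kl.
have /choice[D DP] j := settles_predense nlam (dF j) (cF j).
(* the elements of [kappa] that are not used as indices get the set {1} *)
pose E gamma : set P := [set p |
  (exists2 j, val (h j) = veq gamma & D j p) \/
  (~ (exists j, val (h j) = veq gamma) /\ p = \top)].
have Eh j gamma : val (h j) = veq gamma -> E gamma = D j.
  move=> hj; apply/seteqP; split=> p; last by left; exists j.
  move=> [[j' hj']|[[]]]; last by exists j.
  by have -> : j' = j by apply/hI/val_inj; rewrite hj.
have [||g gF gD] := bfa E.
- by move=> x y /veq_classE xy; rewrite /E xy.
- move=> gamma _; have [[j /Eh->]|nj] := pselect (exists j, val (h j) = veq gamma).
    by have [] := DP j.
  have -> : E gamma = [set \top].
    apply/seteqP; split=> p; last by right.
    by case=> [[j hj _]|[]//]; case: nj; exists j.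
  split=> [p|]; first by exists \top => //; exists p; split=> //; exact: lex1.
  have [n _] := nlam; apply: (@card_le_in _ _ _ _ (fun=> val (n 0))).
    by move=> x _; apply: set_mem; exact: valP.
  by move=> x y -> ->.
exists g => // j; have /set_mem[gamma gk hj] := valP (h j).
have [p [gp]] := gD _ gk; rewrite (Eh j) // => Djp.
by exists p; split=> //; have [_ _] := DP j; apply.
Qed.

(** An infinite kappa bounds the number of finite sequences of its elements, and
    hence of any requirements coded by these. For a finite kappa there are
    countably many such codes, and these requirements can be met without any
    forcing axiom; so [L] is kappa or the natural numbers. *)
Lemma BFA_settling_codes lam kappa : ord_le kappa lam -> BFA P lam kappa ->
  exists L : Type, [/\ embeds nat L, embeds (L * L) L,
    embeds (set_type (vcard kappa)) L
    & forall (J : Type) (F : J -> set (set P)), embeds J L ->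
      (forall j, F j `<=` @down_closed _ P) ->
      (embeds nat (set_type (vcard lam)) -> forall j, F j #<= vcard lam) ->
      exists2 g : set P, is_filter g & forall j, g `&` settles (F j) !=set0].
Proof.
move=> kl bfa; have [nk|kn] := embeds_total nat (set_type (vcard kappa)).
  exists (set_type (vcard kappa)); split=> //.
  - exact: embeds_square.
  - exact: embeds_refl.
  - move=> J F Jk dF cF; apply: (BFA_settling kl) => //; apply: cF.
    apply: embeds_trans nk _; rewrite -card_leE.
    by apply: vcard_le_members => x /kl.
exists nat; split=> //.
- exact: embeds_refl.
- by apply: embeds_square; exact: embeds_refl.
- move=> J F Jn dF _; apply: countable_settling => //.
  exact: (inhabits (\top : P)).
Qed.

End Boolean.

(** * The truth lemma *)

(** A partial decoding suffices to bound the number of formulas, and is easier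
    to give than an injective encoding of this dependent family. *)
Fixpoint formula_of (t : GenTree.tree nat) (n : nat) : option (formula n) :=
  match t with
  | GenTree.Node 0 [:: GenTree.Leaf i; GenTree.Leaf j] =>
      obind (fun i' => omap (FEq i') (insub j)) (insub i)
  | GenTree.Node 1 [:: GenTree.Leaf i; GenTree.Leaf j] =>
      obind (fun i' => omap (FMem i') (insub j)) (insub i)
  | GenTree.Node 2 [:: t1] => omap (@FNot n) (formula_of t1 n)
  | GenTree.Node 3 [:: t1; t2] =>
      obind (fun phi => omap (FAnd phi) (formula_of t2 n)) (formula_of t1 n)
  | GenTree.Node 4 [:: GenTree.Leaf i; t1] =>
      obind (fun i' => omap (FEx i') (formula_of t1 n.+1)) (insub i)
  | _ => None
  end.

Lemma formula_of_surj n (phi : formula n) : exists t, formula_of t n = Some phi.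
Proof.
elim: phi => [m i j|m i j|m psi [t IH]|m psi [t IHpsi] chi [u IHchi]|m i psi [t IH]].
- by exists (GenTree.Node 0 [:: GenTree.Leaf (i : nat); GenTree.Leaf (j : nat)]);
    rewrite /= !valK.
- by exists (GenTree.Node 1 [:: GenTree.Leaf (i : nat); GenTree.Leaf (j : nat)]);
    rewrite /= !valK.
- by exists (GenTree.Node 2 [:: t]); rewrite /= IH.
- by exists (GenTree.Node 3 [:: t; u]); rewrite /= IHpsi /= IHchi.
- by exists (GenTree.Node 4 [:: GenTree.Leaf (i : nat); t]); rewrite /= IH /= valK.
Qed.

Lemma env_cons0 T n (x : T) (e : 'I_n -> T) : env_cons x e ord0 = x.
Proof. by rewrite /env_cons unlift_none. Qed.

Lemma env_consS T n (x : T) (e : 'I_n -> T) i :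
  env_cons x e (lift ord0 i) = e i.
Proof. by rewrite /env_cons liftK. Qed.

Lemma env_cons_comp T U n (f : T -> U) x (e : 'I_n -> T) :
  (fun i => f (env_cons x e i)) = env_cons (f x) (fun i => f (e i)).
Proof. by apply/funext => i; rewrite /env_cons; case: unlift. Qed.

Lemma env_cons_forall T (Q : T -> Prop) n x (e : 'I_n -> T) :
  Q x -> (forall i, Q (e i)) -> forall i, Q (env_cons x e i).
Proof. by move=> Qx Qe i; rewrite /env_cons; case: unlift. Qed.

Section Matched.
Variables (d : Order.disp_t) (P : porderType d) (g : set P).
Hypothesis gF : is_filter g.
Implicit Types (p q r : P) (Q R : set P) (Phi Psi : Prop).

Lemma filter_up p q : g p -> p <= q -> g q.
Proof. by case: gF => _ up _; exact: up. Qed.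

Lemma filter_meet p q : g p -> g q -> exists r, [/\ g r, r <= p & r <= q].
Proof.
by case: gF => _ _ dir gp gq; have [r gr [rp rq]] := dir p q gp gq; exists r.
Qed.

Definition excludes R : set P := [set p | forall q, q <= p -> ~ R q].

(** The truth lemma for [Phi], where [R] is the set of conditions that force
    [Phi]; that [g] decides [R] is part of it, as [g] need not be generic. *)
Definition matched R Phi : Prop :=
  (Phi /\ g `&` R !=set0) \/ (~ Phi /\ g `&` excludes R !=set0).

Lemma matched_iff R R' Phi Phi' : (forall p, R p <-> R' p) -> (Phi <-> Phi') ->
  matched R Phi -> matched R' Phi'.
Proof.
move=> RR' PP' [[/PP' ph [p [gp /RR' Rp]]]|[nph [p [gp nRp]]]].
  by left; split=> //; exists p.
by right; split=> [/PP'//|]; exists p; split=> // q qp /RR'; exact: nRp.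
Qed.

Lemma matched_not R Phi : down_closed R -> matched R Phi ->
  matched (excludes R) (~ Phi).
Proof.
move=> dR [[ph [p [gp Rp]]]|[nph [p [gp nRp]]]]; last by left; split=> //; exists p.
right; split=> //; exists p; split=> // q qp nRq.
by apply: (nRq q (lexx q)); exact: dR Rp.
Qed.

Lemma matched_and R R' Phi Phi' : down_closed R -> down_closed R' ->
  matched R Phi -> matched R' Phi' -> matched (R `&` R') (Phi /\ Phi').
Proof.
move=> dR dR' [[ph [p [gp Rp]]]|[nph [p [gp nRp]]]]; last first.
  by right; split=> [[]//|]; exists p; split=> // q qp [Rq _]; exact: nRp qp Rq.
case=> [[ph' [p' [gp' Rp']]]|[nph' [p' [gp' nRp']]]]; last first.
  by right; split=> [[]//|]; exists p'; split=> // q qp [_ Rq]; exact: nRp' qp Rq.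
left; split=> //; have [r [gr rp rp']] := filter_meet gp gp'.
by exists r; split=> //; split; [exact: dR Rp|exact: dR' Rp'].
Qed.

Lemma matched_true R Phi p :
  down_closed R -> matched R Phi -> g p -> dense_below R p -> Phi.
Proof.
move=> dR [[]//|[nph [p' [gp' nRp']]]] gp Rp.
have [r [gr rp rp']] := filter_meet gp gp'.
by have [r' r'r Rr'] := Rp r rp; case: (nRp' r' (le_trans r'r rp') Rr').
Qed.

Section Bounded.
Variables (kappa : V) (t : name P) (c : nidx t -> option (set_type (vcard kappa))).
Hypothesis cP : forall i j, c i = c j <-> name_eq (nsub i) (nsub j).

(** Settling this family either puts into the filter one of the conditions with
    which the subname of class [k] occurs in [t], or excludes all of them. *)
Definition cond_family k : set (set P) :=
  [set [set r | r <= q] | q in [set ncond i | i in [set i : nidx t | c i = k]]].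

(** Settling this family either chooses a class of subnames of [t] whose members
    are forced to be in [t] and to satisfy [R], or excludes that there is one.
    The conditions are collected by classes, as there are few classes but
    possibly many indices. *)
Definition ex_family (R : name P -> set P) : set (set P) :=
  [set [set r | exists i, [/\ c i = k, r <= ncond i & R (nsub i) r]]
     | k in range c].

(** If the filter has settled [ex_family R] positively, at the class of [i], then
    [R] holds of [nsub i] by the induction hypothesis, and [cond_family] ensures
    that [nsub i] is really evaluated to an element of the value of [t]. If it
    has settled it negatively, then a witness in the value of [t] would give a
    condition in the filter that contradicts this. *)
Lemma matched_forces_ex (R : name P -> set P) (Phi : V -> Prop) :
  separative P ->
  (forall u, down_closed (R u)) ->
  (forall u v p, name_eq u v -> R u p -> R v p) ->
  (forall x y, veq x y -> Phi x -> Phi y) ->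
  g `&` settles (ex_family R) !=set0 ->
  (forall k, g `&` settles (cond_family k) !=set0) ->
  (forall i : nidx t, matched (R (nsub i)) (Phi (eval g (nsub i)))) ->
  matched (forces_ex t R) (exists2 x, vmem x (eval g t) & Phi x).
Proof.
move=> sepP dR RE PhiE [p [gp sp]] sc mR.
case: sp => [[_ [_ [i _ <-] <-] pR]|none].
  left; split; last first.
    by exists p; split=> //; apply: dense_below_sub pR => r [j [_ rj Rj]]; exists j.
  have Phii : Phi (eval g (nsub i)).
    apply: (matched_true (dR _) (mR i) gp); apply: dense_below_sub pR.
    by move=> r [j [/cP ji _ Rj]]; exact: RE Rj.
  have [p' [gp' [[_ [_ [j ji <-] <-] p'j]|none]]] := sc (c i).
    exists (eval g (nsub j)).
      apply/vmem_eval; exists j; last exact: veq_refl.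
      by apply: filter_up gp' _; exact: sepP.
    by apply: PhiE Phii; apply: eval_name_eq; apply/cP.
  have [r [gr rp rp']] := filter_meet gp gp'.
  have [r' r'r [j [ji r'j _]]] := pR r rp.
  exfalso; apply: (none [set q | q <= ncond j] r') r'j; last exact: le_trans rp'.
  by exists (ncond j) => //; exists j.
have fam_i i : ex_family R
    [set r | exists j, [/\ c j = c i, r <= ncond j & R (nsub j) r]].
  by exists (c i) => //; exists i.
right; split; last first.
  exists p; split=> // q qp exq; have [r rq [i ri Rr]] := exq q (lexx q).
  by apply: (none _ r (fam_i i)); [exact: le_trans qp|exists i].
move=> [x /vmem_eval[i gi xi] Phix].
case: (mR i) => [[_ [p' [gp' Rp']]]|[]]; last by case; exact: PhiE Phix.
have [q [gq qp qp']] := filter_meet gp gp'.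
have [r [gr rq ri]] := filter_meet gq gi.
apply: (none _ r (fam_i i)); first exact: le_trans qp.
by exists i; split=> //; apply: dR Rp'; exact: le_trans qp'.
Qed.

Lemma cond_family_down k : cond_family k `<=` @down_closed _ P.
Proof. by move=> _ [q _ <-] p r rp; exact: le_trans. Qed.

Lemma ex_family_down (R : name P -> set P) : (forall u, down_closed (R u)) ->
  ex_family R `<=` @down_closed _ P.
Proof.
move=> dR _ [k _ <-] p q qp [i [ci pi Rp]]; exists i; split=> //.
  exact: le_trans pi.
exact: dR Rp.
Qed.

Lemma cond_family_small lam k : locally_bounded lam t ->
  cond_family k #<= vcard lam.
Proof.
move=> bt; apply: card_le_trans (card_image_le _ _) _.
have [[i ci]|ni] := pselect (exists i, c i = k).
  apply: card_le_trans (locally_bounded_conds i bt); apply: subset_card_le.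
  by move=> _ [j cj <-]; exists j => //=; apply/cP; rewrite ci cj.
suff -> : [set i : nidx t | c i = k] = set0 by rewrite image_set0 card_ge0.
by apply/seteqP; split=> // i ci; case: ni; exists i.
Qed.

Lemma ex_family_small lam (R : name P -> set P) : ord_le kappa lam ->
  embeds nat (set_type (vcard lam)) -> ex_family R #<= vcard lam.
Proof.
move=> kl nlam; apply: card_le_trans (card_image_le _ _) _.
apply: card_le_trans (card_leT _) _; rewrite card_leE.
have ko : embeds (option (set_type (vcard kappa))) (set_type (vcard lam)).
  apply: embeds_option nlam (embeds_square nlam) _ _; rewrite -card_leE.
  by apply: vcard_le_members => x /kl.
by apply: embeds_trans ko; exists val; exact: val_inj.
Qed.

End Bounded.
End Matched.

(** Equality reduced to membership by quantifiers of the kind that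
    [matched_forces_ex] handles. *)
Lemma forces_eq_ext d (P : porderType d) (s t : name P) (p : P) :
  forces_eq s t p <->
  excludes (forces_ex s (fun u => excludes (forces_mem u t))) p /\
  excludes (forces_ex t (fun u => excludes (forces_mem u s))) p.
Proof.
have memE (x y : name P) q : (forall i r, r <= q -> r <= ncond i ->
      forces_mem (@nsub _ x i) y r) <->
    excludes (forces_ex x (fun u => excludes (forces_mem u y))) q.
  split=> [xy r rq ex|xy i r rq ri r' r'r].
    have [r' r'r [i r'i nmem]] := ex r (lexx r).
    by apply: (nmem r' (lexx _)); apply: xy => //; exact: le_trans rq.
  apply: contrapT => none; apply: (xy r'); first exact: le_trans rq.
  move=> q' q'r'; exists q' => //; exists i.
    by apply: le_trans q'r' (le_trans r'r ri).
  move=> q'' q''q' mem; apply: none.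
  have [r3 r3q [j rj]] := mem q'' (lexx _); exists r3; last by exists j.
  by apply: le_trans r3q (le_trans q''q' q'r').
split=> [/forces_eqE[st ts]|[/memE st /memE ts]]; last first.
  apply/forces_eqE; split=> // j q qp qj.
  apply: dense_below_sub (ts j q qp qj) => r [i [ri ji]]; exists i => //.
  exact: forces_eq_sym.
split; apply/memE => // j q qp qj.
apply: dense_below_sub (ts j q qp qj) => r [i ri ij]; exists i; split=> //.
exact: forces_eq_sym.
Qed.

Section Truth.
Variables (d : Order.disp_t) (P : porderType d) (sepP : separative P).
Variables (kappa lam : V) (kl : ord_le kappa lam).
Variables (n : nat) (s : 'I_n.+1 -> name P).
Hypothesis s_small : forall i, name_small kappa (s i).
Hypothesis s_bounded : forall i, name_bounded lam (s i).

Let K := option (set_type (vcard kappa)).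

(* The option type provides a value for the names that are not locally small,
   and it does so even if [kappa] is empty. *)
Let class_ex (t : name P) : exists c : nidx t -> K, locally_small kappa t ->
  forall i j, c i = c j <-> name_eq (nsub i) (nsub j).
Proof.
have [st|nst] := pselect (locally_small kappa t); last by exists (fun=> None).
have [c cP] := locally_smallP st; exists (Some \o c) => _ i j.
by split=> [[/cP]|/cP /= ->].
Qed.

Let class (t : name P) : nidx t -> K := projT1 (cid (class_ex t)).

Let classP (t : name P) : locally_small kappa t ->
  forall i j : nidx t, class i = class j <-> name_eq (nsub i) (nsub j).
Proof. by rewrite /class; case: cid. Qed.

(** If [k] is not the class of a subname, then [t] itself is as good as any other
    hereditary subname. *)
Definition child (k : K) (t : name P) : name P :=
  if pselect (exists i : nidx t, class i = k) is left ex
  then nsub (projT1 (cid ex)) else t.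

(** A code (i, [:: k_1; ...; k_m]) stands for the subname of [s i] that is
    reached by choosing elements of the classes k_m, ..., k_1 in turn. *)
Definition code : Type := (nat * seq K)%type.

Definition node (y : code) : name P := foldr child (s (inord y.1)) y.2.

Let node_hereditary y : name_small kappa (node y) /\ name_bounded lam (node y).
Proof.
case: y => i l; rewrite /node /=; elim: l => [|k l [sl bl]] //=.
rewrite /child; case: pselect => // ex.
by split; [exact: name_small_sub|exact: name_bounded_sub].
Qed.

Let node_small y : locally_small kappa (node y).
Proof. by have [/name_small_locally] := node_hereditary y. Qed.

Lemma node_child y (i : nidx (node y)) : exists z, name_eq (nsub i) (node z).
Proof.
exists (y.1, class i :: y.2); rewrite /node /= -/(node y) /child.
case: pselect => [ex|]; last by case; exists i.
by case: cid => j /= /esym; apply: (classP (node_small y) _ _).1.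
Qed.

(** On the left: the arity and a code of a formula, its parameters, and the name
    that bounds its first variable. On the right: a name and a class. *)
Definition index : Type :=
  ((nat * GenTree.tree nat * seq code * code) + (code * K))%type.

Definition family (w : index) : set (set P) :=
  match w with
  | inl (m, t, es, y) =>
      if formula_of t m.+1 is Some phi then
        ex_family (@class (node y)) (fun u => forces phi
          (env_cons u (fun i : 'I_m => node (nth (0, [::]) es i))))
      else set0
  | inr (y, k) => cond_family (@class (node y)) k
  end.

Lemma index_embeds (L : Type) : embeds nat L -> embeds (L * L) L ->
  embeds (set_type (vcard kappa)) L -> embeds index L.
Proof.
move=> nL sL kL; have KL : embeds K L by exact: embeds_option.
have cL : embeds code L by apply: embeds_prod => //; exact: embeds_seq.
have tL : embeds (GenTree.tree nat) L.
  by apply: embeds_trans nL; exists pickle; exact: pcan_inj pickleK.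
apply: embeds_sum => //; last exact: embeds_prod.
apply: embeds_prod => //; apply: embeds_prod => //; last exact: embeds_seq.
exact: embeds_prod.
Qed.

Lemma family_down w : family w `<=` @down_closed _ P.
Proof.
case: w => [[[[m t] es] y]|[y k]] /=; last exact: cond_family_down.
by case: formula_of => // phi; apply: ex_family_down => u p q; exact: forces_le.
Qed.

Lemma family_small : embeds nat (set_type (vcard lam)) ->
  forall w, family w #<= vcard lam.
Proof.
move=> nlam [[[[m t] es] y]|[y k]] /=.
  by case: formula_of => [phi|]; [exact: ex_family_small|exact: card_ge0].
apply: cond_family_small; first exact: classP.
by apply: name_bounded_locally; have [] := node_hereditary y.
Qed.

Variable g : set P.
Hypothesis gF : is_filter g.
Hypothesis g_settles : forall w, g `&` settles (family w) !=set0.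

Let val_of (y : code) : V := eval g (node y).

Lemma truth_ex m (phi : formula m.+1) (e : 'I_m -> code) y :
  (forall z, (exists i : nidx (node y), name_eq (nsub i) (node z)) ->
     matched g (forces phi (env_cons (node z) (node \o e)))
               (sat phi (env_cons (val_of z) (val_of \o e)))) ->
  matched g (forces_ex (node y) (fun u => forces phi (env_cons u (node \o e))))
    (exists2 x, vmem x (val_of y) & sat phi (env_cons x (val_of \o e))).
Proof.
move=> IH.
have phiE u v p : name_eq u v -> forces phi (env_cons u (node \o e)) p ->
    forces phi (env_cons v (node \o e)) p.
  by move=> uv; apply: forces_congr_cons; exact: name_eq_forces.
have satE u v : veq u v -> sat phi (env_cons u (val_of \o e)) ->
    sat phi (env_cons v (val_of \o e)).
  move=> uv; apply: sat_congr; apply: (env_cons_congr (R := veq)) => // i.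
  exact: veq_refl.
apply: (matched_forces_ex gF (classP (node_small y)) sepP _ phiE satE).
- by move=> u p q; exact: forces_le.
- have [t tphi] := formula_of_surj phi.
  have := g_settles (inl (m, t, [seq e i | i <- enum 'I_m], y)).
  (* the default value of [nth] does not matter: every [i] is in the list *)
  rewrite /= tphi; congr (g `&` settles (ex_family _ _) !=set0).
  apply/funext => u; congr (forces phi (env_cons u _)); apply/funext => i /=.
  by rewrite (nth_map i) ?size_enum_ord ?ltn_ord // nth_ord_enum.
- by move=> k; exact: (g_settles (inr (y, k))).
- move=> i; have [z iz] := node_child i.
  apply: matched_iff (IH z _); last by exists i.
    by move=> p; split; apply: phiE; [exact: name_eq_sym|].
  by split; apply: satE; [apply: veq_sym|]; exact: eval_name_eq.
Qed.

Let down_mem (t u : name P) : down_closed (forces_mem t u).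
Proof. by move=> p q; exact: forces_mem_le. Qed.

Lemma truth_mem y z :
  (forall w, (exists i : nidx (node z), name_eq (nsub i) (node w)) ->
     matched g (forces_eq (node y) (node w)) (veq (val_of y) (val_of w))) ->
  matched g (forces_mem (node y) (node z)) (vmem (val_of y) (val_of z)).
Proof.
move=> IH.
pose phi : formula 2 := FEq (lift ord0 ord0) ord0.
have phiE u p : forces phi (env_cons u (node \o fun=> y)) p <->
    forces_eq (node y) u p by rewrite /= env_cons0 env_consS.
have satE x : sat phi (env_cons x (val_of \o fun=> y)) <-> veq (val_of y) x.
  by rewrite /= env_cons0 env_consS.
apply: (matched_iff _ _ (@truth_ex 1 phi (fun=> y) z _)).
- move=> p; apply: iff_trans (iff_sym (forces_memE _ _ _)).
  by split; apply: dense_below_sub => r [i ri /phiE yi]; exists i.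
- split=> [[x xz /satE yx]|/vmem_eval[i gi yi]].
    by apply: vmem_veql xz; exact: veq_sym.
  exists (eval g (nsub i)); last exact/satE.
  by apply/vmem_eval; exists i => //; exact: veq_refl.
- move=> w zw; apply: matched_iff (IH w zw) => [p|]; exact: iff_sym.
Qed.

(** Both halves of the definition compare a subname of [node y] with a subname
    of [node z], so that induction on [node y] alone suffices. *)
Lemma truth_eq y z :
  matched g (forces_eq (node y) (node z)) (veq (val_of y) (val_of z)).
Proof.
have [t] : exists t, name_eq t (node y) by exists (node y); exact: name_eq_refl.
elim: t y z => I f IH c y z ty.
have IHy i w v : name_eq (@nsub _ (node y) i) (node w) ->
    matched g (forces_eq (node w) (node v)) (veq (val_of w) (val_of v)).
  case: (node y) ty i => J h e [_ hf] i iw.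
  have [k [ki _]] := hf i; exact: (IH k) (name_eq_trans ki iw).
have subset_matched y1 y2 :
    (forall w, (exists i : nidx (node y1), name_eq (nsub i) (node w)) ->
       matched g (forces_mem (node w) (node y2)) (vmem (val_of w) (val_of y2))) ->
    matched g
      (excludes (forces_ex (node y1) (fun u => excludes (forces_mem u (node y2)))))
      (~ exists2 x, vmem x (val_of y1) & ~ vmem x (val_of y2)).
  move=> mem12; apply: matched_not; first by move=> p q; exact: dense_below_le.
  pose phi : formula 2 := FNot (FMem ord0 (lift ord0 ord0)).
  have phiE u p : forces phi (env_cons u (node \o fun=> y2)) p <->
      excludes (forces_mem u (node y2)) p by rewrite /= env_cons0 env_consS.
  have satE x : sat phi (env_cons x (val_of \o fun=> y2)) <->
      ~ vmem x (val_of y2) by rewrite /= env_cons0 env_consS.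
  apply: (matched_iff _ _ (@truth_ex 1 phi (fun=> y2) y1 _)).
  - by move=> p; split; apply: dense_below_sub => r [i ri /phiE yi]; exists i.
  - by split=> -[x x1 /satE x2]; exists x.
  - move=> w wy1; have := matched_not (@down_mem _ _) (mem12 w wy1).
    by apply: matched_iff => [p|]; exact: iff_sym.
apply: matched_iff (matched_and gF _ _
  (subset_matched y z _) (subset_matched z y _)).
- by move=> p; exact: iff_sym (forces_eq_ext _ _ _).
- split=> [[yz zy]|/veqP yz].
    apply/veqP/seteqP; split=> x xy; apply: contrapT => nx.
      by apply: yz; exists x.
    by apply: zy; exists x.
  by split=> -[x]; rewrite !vmemE yz.
- by move=> p q qp ex r rq; apply: ex; exact: le_trans qp.
- by move=> p q qp ex r rq; apply: ex; exact: le_trans qp.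
- by move=> w [i iw]; apply: truth_mem => v _; exact: IHy iw.
- move=> w _; apply: truth_mem => v [i iv].
  apply: matched_iff (IHy i v w iv) => [p|]; last by split; exact: veq_sym.
  by split; exact: forces_eq_sym.
Qed.

Lemma truth m (phi : formula m) (e : 'I_m -> code) :
  matched g (forces phi (node \o e)) (sat phi (val_of \o e)).
Proof.
elim: phi e => [k i j|k i j|k psi IH|k psi IHpsi chi IHchi|k i psi IH] e /=.
- exact: truth_eq.
- by apply: truth_mem => w _; exact: truth_eq.
- by apply: matched_not => // p q; exact: forces_le.
- by apply: matched_and => // p q; exact: forces_le.
- apply: (matched_iff _ _ (@truth_ex _ psi e (e i) _)) => [p||z _].
  + exact: iff_sym (forces_FEx _ _ _ _).
  + by [].
  + have := IH (env_cons z e).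
    rewrite (_ : node \o _ = env_cons (node z) (node \o e)); last first.
      exact: env_cons_comp.
    rewrite (_ : val_of \o _ = env_cons (val_of z) (val_of \o e)) //.
    exact: env_cons_comp.
Qed.

Lemma truth_parameters (phi : formula n.+1) p :
  g p -> forces phi s p -> sat phi (eval g \o s).
Proof.
move=> gp phip; have := truth phi (fun i => (i : nat, [::])).
rewrite (_ : node \o _ = s); last first.
  by apply/funext => i; rewrite /node /= inord_val.
rewrite (_ : val_of \o _ = eval g \o s); last first.
  by apply/funext => i; rewrite /= /val_of /node /= inord_val.
case=> [[]//|[_ [q [gq nq]]]].
have [r [gr rp rq]] := filter_meet gF gp gq.
by case: (nq r rq); exact: forces_le phip.
Qed.

End Truth.


(** * The implications *)

Section Implications.
Variables (d : Order.disp_t) (B : ctbDistrLatticeType d).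
Variable nontriv : (\top : B) != \bot.
Hypothesis complete : forall S : set B, supremums S !=set0.
Variables kappa lam : V.
Let P := nonzero nontriv.

Lemma BFA_S0BN : ord_le kappa lam -> BFA P lam kappa ->
  forall n (s : 'I_n.+1 -> name P),
    (forall i, name_small kappa (s i) /\ name_bounded lam (s i)) ->
    exists2 g : set P, is_filter g &
      forall phi : formula n.+1, forces phi s \top ->
        sat phi (fun i => eval g (s i)).
Proof.
move=> kl bfa n s sP.
have s_small i := (sP i).1; have s_bounded i := (sP i).2.
have [L [nL sL kL settle]] := BFA_settling_codes complete kl bfa.
have [|||g gF gS] := settle (index kappa) (family (kappa := kappa) s).
- exact: index_embeds.
- exact: family_down.
- exact: family_small.
exists g => // phi; apply: truth_parameters (filter_top gF) => //.
exact: nonzero_separative.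
Qed.
End Implications.

Section FromNames.
Variables (d : Order.disp_t) (P : tPOrderType d).
Variables kappa lam : V.

(** The filter is correct about the equality of [s] and the canonical name of [A].
    The latter is bounded by [lam] unless [lam] is empty; but then [s] is the
    empty name, and there is nothing to do. *)
Lemma eval_eq_of_truth (s : name P) A : locally_bounded lam s ->
  forces_eq s (check P A) \top ->
  (vcard lam !=set0 -> exists2 g : set P, is_filter g &
     forall phi : formula 2, forces phi (env_cons s (fun=> check P A)) \top ->
       sat phi (fun i => eval g (env_cons s (fun=> check P A) i))) ->
  exists2 g : set P, is_filter g & veq (eval g s) A.
Proof.
move=> bs sA truth; have [/truth[g gF gT]|lam0] := pselect (vcard lam !=set0).
  have gtop := filter_top gF.
  exists g => //; apply: veq_trans (eval_check A gtop).
  have := gT (FEq ord0 (lift ord0 ord0)).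
  by rewrite /= !env_cons0 !env_consS; apply.
have s0 : nidx s -> False.
  move=> i; apply: lam0; have /card_leW[f [fl _]] := locally_bounded_conds i bs.
  exists (f (ncond i)); apply: fl; exists i => //; exact: name_eq_refl.
have [g gF] := filter_exists P; exists g => //; apply/veqP/seteqP; split=> x.
  by move=> /vmem_eval[i].
case: A sA {truth} => A f /forces_eqE[_ fs] [a _].
by have [r _ [i]] := fs a \top (lexx _) (lexx _) \top (lexx _); case: (s0 i).
Qed.

Lemma S0BN_BN X alpha : vordinal alpha ->
  S0BN P lam X kappa alpha -> BN P lam X kappa alpha.
Proof.
move=> oalpha s0bn s A ss bs rs HA XA sA.
apply: (eval_eq_of_truth (name_bounded_locally bs) sA) => lam0.
apply: s0bn; apply: (env_cons_forall (Q := fun t => [/\ name_small kappa t,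
  name_bounded lam t & ord_le (name_rank X t) alpha])) => // _.
by split; [exact: check_small|exact: check_bounded|exact: check_rank].
Qed.

Lemma S0BN_inf_BN_inf : S0BN_inf P lam kappa -> BN_inf P lam kappa.
Proof.
move=> s0bn alpha X oalpha tX HX; apply: S0BN_BN => // n s sP.
apply: s0bn; exists X; split=> // i; have [ss bs rs] := sP i.
by split=> //; exists alpha.
Qed.

(** The forcing may be too large for its elements to index a name; the sets
    [D gamma] are enumerated by pairs of indices of [kappa] and [lam] instead. *)
Lemma predense_enumeration (D : V -> set P) :
  (forall gamma, vmem gamma kappa -> D gamma #<= vcard lam) ->
  exists (I : Type) (a : I -> vidx kappa) (c : I -> P),
    forall b p, D (velt b) p <-> exists2 i, a i = b & c i = p.
Proof.
move=> cD.
have /choice[f fP] (a : vidx kappa) := card_leW (cD _ (vmem_velt a)).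
pose coded (bl : vidx kappa * vidx lam) p :=
  D (velt bl.1) p /\ f bl.1 p = veq (velt bl.2).
pose I := {bl | exists p, coded bl p}.
have /choice[c cP] (i : I) : exists p, coded (sval i) p by case: i.
exists I, (fun i => (sval i).1), c => b p; split; last first.
  by move=> [i <- <-]; have [] := cP i.
have [fl fI] := fP b => Dp; have [y [l yl] yE] := fl p Dp.
have fpl : f b p = veq (velt l) by rewrite -yE; exact/veq_classE.
have ex : exists p, coded (b, l) p by exists p.
exists (exist _ (b, l) ex : I) => //.
by have [Dq fq] := cP (exist _ (b, l) ex : I); apply: fI => //; rewrite fpl.
Qed.

(** The name that puts x_gamma into its value with the conditions in D_gamma is
    forced to be the set of all the x_gamma, as the D_gamma are predense. A
    filter that evaluates it correctly meets every D_gamma. *)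
Lemma BN_BFA X alpha : vordinal alpha -> inhabited (vidx alpha) ->
  vtransitive X -> vcard X #<= vcard kappa ->
  vcard kappa #<= modulo veq (iter_pow_lt X alpha) ->
  BN P lam X kappa alpha -> BFA P lam kappa.
Proof.
move=> oalpha a0 tX cX calpha bn D Dveq DP.
have [[b0]|k0] := pselect (inhabited (vidx kappa)); last first.
  have [g gF] := filter_exists P; exists g => // gamma [b].
  by case: k0; exists.
have lam0 : vcard lam !=set0.
  have [/(_ \top)[p Dp _] /card_leW[f [fl _]]] := DP _ (vmem_velt b0).
  by exists (f p); exact: fl.
have [beta [beta_alpha cbeta Hbeta]] := iter_pow_lt_Hplus oalpha tX cX calpha.
have [x [xbeta xE]] : exists x : vidx kappa -> V,
    (forall b, iter_pow_lt X beta (x b)) /\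
    forall b b', veq (x b) (x b') <-> veq (velt b) (velt b').
  have [f [fbeta fI]] := card_leW cbeta.
  have kb (b : vidx kappa) : vcard kappa (veq (velt b)).
    by exists (velt b) => //; exact: vmem_velt.
  have /choice[x xP] : forall b : vidx kappa, exists x, iter_pow_lt X beta x /\
      veq x = f (veq (velt b)).
    by move=> b; have [x] := fbeta _ (kb b); exists x.
  exists x; split=> [b|b b']; first by have [] := xP b.
  rewrite -!veq_classE (xP b).2 (xP b').2.
  by split=> [/fI|->//]; apply; exact: kb.
have [I [a [c cP]]] := predense_enumeration (fun gamma k => (DP gamma k).2).
pose s := Name (fun i => check P (x (a i))) c.
have Hx b : Hplus kappa (x b) by exact: Hbeta.
have small : name_small kappa s.
  split=> [|i]; last exact: check_small.
  apply: (modulo_le (k := @velt kappa) (h := fun b => check P (x b)) veq_refl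
    (@name_eq_sym _) (@name_eq_trans _)) => [b|t [p [i [ti _]]]|b b'].
  - exact: vmem_velt.
  - by exists (a i).
  - by move=> bb'; apply/check_eq/xE.
have bounded : name_bounded lam s.
  split=> [|i]; last exact: check_bounded.
  exists [set t | exists b, name_eq t (check P (x b))].
  exists (fun t => [set p | exists2 b, name_eq t (check P (x b)) & D (velt b) p]).
  split=> [t p|t [b tb]]; first split=> [[i [ti <-]]|[_ [b tb /cP[i ai ci]]]].
  - by split; [exists (a i)|exists (a i) => //; apply/cP; exists i].
  - by exists i; split=> //=; rewrite ai.
  - have [_] := DP _ (vmem_velt b); apply: card_le_trans; apply: subset_card_le.
    move=> p [b' tb' Dp]; rewrite (Dveq _ (velt b')) //; apply/xE/check_eq.
    by apply: name_eq_trans tb'; exact: name_eq_sym.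
have xalpha b : exists2 g, vmem g alpha & iter_pow X g (x b).
  by have /iter_pow_ltE[g /beta_alpha ga xg] := xbeta b; exists g.
have rank : ord_le (name_rank X s) alpha.
  apply: name_rank_le => // i; have [g ga xg] := xalpha (a i).
  by exists g => //; apply: check_rank => //; exact: vordinal_mem ga.
have HA : Hplus kappa (vset x).
  split=> //; apply: (modulo_le (k := @velt kappa) (h := x) veq_refl
    veq_sym veq_trans) => [b|y [b yb]|b b' bb'].
  - exact: vmem_velt.
  - by exists b.
  - exact/xE.
have XA : iter_pow X alpha (vset x).
  rewrite iter_pow_pos // => y [b yb]; have [g ga xg] := xalpha b.
  apply/iter_pow_ltE; exists g => //; apply: iter_pow_veqr xg; exact: veq_sym.
have forced : forces_eq s (check P (vset x)) \top.
  apply/forces_eqE; split=> [i|b] q _ _ r rq.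
    exists r => //; exists (a i); split; [exact: lex1|exact: forces_eq_refl].
  have [/(_ r)[p /cP[i ai ci] [r' [r'r r'p]]] _] := DP _ (vmem_velt b).
  exists r' => //; exists i; first by rewrite /= ci.
  by rewrite /= ai; exact: forces_eq_refl.
have [g gF gA] := bn s (vset x) small bounded rank HA XA forced.
have gtop := filter_top gF.
exists g => // gamma [b gb].
have /vmem_eval[i gi bi] : vmem (x b) (eval g s).
  by apply: vmem_veqr (veq_sym gA) _; exact: (@vmem_velt (vset x)).
exists (c i); split=> //.
rewrite (Dveq gamma (velt (a i))); first by apply/cP; exists i.
apply: veq_trans gb _; apply/xE; apply: veq_trans bi _; exact: eval_check.
Qed.

(** The elements of [kappa] itself can serve as the x_gamma: take X = kappa and
    alpha = 1. *)
Lemma BN_inf_BFA : vordinal kappa -> BN_inf P lam kappa -> BFA P lam kappa.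
Proof.
move=> [tk _] bn; have o1 := vordinal_succ vordinal_empty.
apply: (@BN_BFA kappa (vsucc vempty)) => //.
- exact: (inhabits None).
- apply: vcard_le_members => x xk; apply/iter_pow_ltE; exists vempty.
    by apply/vmem_succ; right; exact: veq_refl.
  by rewrite iter_pow_zero // => -[[]].
- by apply: bn => //; apply: Hplus_transitive => //; exact: card_lexx.
Qed.

End FromNames.

Theorem theorem4p2 (d : Order.disp_t) (B : ctbDistrLatticeType d)
    (B_set : set_sized B)
    (nontriv : (\top : B) != \bot)
    (complete : forall S : set B, supremums S !=set0)
    (kappa lam : V) (kappa_card : vcardinal kappa) (lam_card : vcardinal lam) :
  let P := nonzero nontriv in
  ((S0BN_inf P lam kappa -> BN_inf P lam kappa) /\
   (BN_inf P lam kappa -> BFA P lam kappa) /\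
   (ord_le kappa lam -> BFA P lam kappa -> S0BN_inf P lam kappa)) /\
  (forall alpha X : V, vordinal alpha -> vmem vempty alpha ->
     vtransitive X -> vcard X #<= vcard kappa ->
     (S0BN P lam X kappa alpha -> BN P lam X kappa alpha) /\
     (vcard kappa #<= modulo veq (iter_pow_lt X alpha) ->
        BN P lam X kappa alpha -> BFA P lam kappa) /\
     (ord_le kappa lam -> BFA P lam kappa -> S0BN P lam X kappa alpha)).
Proof.
move=> P; split; first split; [|split|].
- exact: S0BN_inf_BN_inf.
- by apply: BN_inf_BFA; case: kappa_card.
- move=> kl bfa n s [X [_ _ sP]]; apply: BFA_S0BN kl bfa _ _ _ => // i.
  by have [] := sP i.
- move=> alpha X oalpha [a _] tX cX; split; [|split].
  + exact: S0BN_BN.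
  + by apply: BN_BFA => //; exists.
  + move=> kl bfa n s sP; apply: BFA_S0BN kl bfa _ _ _ => // i.
    by have [] := sP i.
Qed.
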